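(* Let $L$ be a self-adjoint positive definite operator in a Hilbert space $\mathbf{H}$. For $\alpha>0$ and $1\le q\le\infty$ the norm of the Besov space $\mathcal{B}^{\alpha}_{\mathbf{H},q}(\sqrt{L})$ is equivalent to $$\|f\|_{\mathbf{H}}+\left(\sum_{j=0}^{\infty}\left(2^{j\alpha}\,\mathcal{E}(f,2^{j})\right)^{q}\right)^{1/q}$$ (with the standard modification, supremum over $j\geq 0$, for $q=\infty$), where $\mathcal{E}(f,\omega)=\inf_{g\in\mathbf{PW}_{\omega}(\sqrt{L})}\|f-g\|_{\mathbf{H}}$.
   Context: $\mathbf{H}^r$ is the domain of $L^{r/2}$ with norm $\|f\|_{\mathbf{H}}+\|L^{r/2}f\|_{\mathbf{H}}$. $\mathcal{B}^{\alpha}_{\mathbf{H},q}(\sqrt{L})=(\mathbf{H},\mathbf{H}^{r})^{K}_{\theta,q}$ with $0<\theta=\alpha/r<1$, $r\in\mathbb{N}$, i.e. the space of $f\in\mathbf{H}$ with finite norm $\left(\int_0^\infty(t^{-\theta}K(f,t))^q\frac{dt}{t}\right)^{1/q}$ (supremum for $q=\infty$), where $K(f,t)=\inf_{f=f_0+f_1,\ f_0\in\mathbf{H},\ f_1\in\mathbf{H}^r}(\|f_0\|_{\mathbf{H}}+t\|f_1\|_{\mathbf{H}^r})$. $\mathbf{PW}_{\omega}(\sqrt{L})$ is the closed subspace of vectors $f\in\mathbf{H}$ whose Spectral Fourier Transform $\mathcal{F}f$ is supported in $[0,\omega]$, where $\mathcal{F}$ is the unitary map from $\mathbf{H}$ onto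 a direct integral $\int X(\lambda)\,dm(\lambda)$ with $\mathcal{F}(L^{k/2}f)(\lambda)=\lambda^k(\mathcal{F}f)(\lambda)$; equivalently, the range of the spectral projection of $\sqrt{L}$ for $[0,\omega]$. *)

(* Defs.v *)
From HB Require Import structures.
From mathcomp Require Import all_boot all_order all_algebra sesquilinear.
From mathcomp Require Import complex.
From mathcomp Require Import all_classical all_reals all_analysis.

Set Implicit Arguments.
Unset Strict Implicit.
Unset Printing Implicit Defensive.

Import Order.TTheory GRing.Theory Num.Theory.
Import numFieldNormedType.Exports.

Local Open Scope classical_set_scope.
Local Open Scope ring_scope.
Local Open Scope complex_scope.

(* Complex Hilbert spaces; dot is linear in its first argument. *)
HB.mixin Record CompleteNormedModule_isHilbert (R : realType) H
    & CompleteNormedModule R[i] H := {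
  dot : {dot H for Num.conj} ;
  sqr_norm_dot : forall u : H, `|u| ^+ 2 = dot u u }.

HB.structure Definition Hilbert (R : realType) :=
  {H of CompleteNormedModule_isHilbert R H & CompleteNormedModule R[i] H}.
Notation hilbertType := Hilbert.type.

(* The norm of a normedModType over R[i] takes its values in R[i]. *)
Definition hnorm (R : realType) (H : hilbertType R) (u : H) : R :=
  complex.Re `|u|.

(* Linear operators with a domain; op_fun is irrelevant outside op_dom. *)
Record operator (R : realType) (H : hilbertType R) := Operator {
  op_dom : set H ;
  op_fun :> H -> H ;
  op_dom0 : op_dom 0 ;
  op_domP : forall (a : R[i]) u v,
    op_dom u -> op_dom v -> op_dom (a *: u + v) ;
  op_linear : forall (a : R[i]) u v,
    op_dom u -> op_dom v -> op_fun (a *: u + v) = a *: op_fun u + op_fun v }.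

(* The left-hand side of the equivalence is the graph of the adjoint of L. *)
Definition self_adjoint (R : realType) (H : hilbertType R) (L : operator H) :
    Prop :=
  dense (op_dom L) /\
  forall f h : H, (forall g, op_dom L g -> dot (L g) f = dot g h) <->
                  (op_dom L f /\ L f = h).

(* In R[i], 0 < z means that z is real and positive. *)
Definition positive_definite (R : realType) (H : hilbertType R)
    (L : operator H) : Prop :=
  forall f : H, op_dom L f -> f != 0 -> 0 < dot (L f) f.

(* Projection-valued measures on the Borel sets of the real line (idempotence
   is the case A = B of pvmI). *)
Record pvm (R : realType) (H : hilbertType R) := Pvm {
  pvm_proj :> set R -> H -> H ;
  pvm_linear : forall B, measurable B -> linear (pvm_proj B) ;
  pvm_sym : forall B, measurable B ->
    forall u v, dot (pvm_proj B u) v = dot u (pvm_proj B v) ;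
  pvm0 : forall u, pvm_proj set0 u = 0 ;
  pvmT : forall u, pvm_proj setT u = u ;
  pvmI : forall A B, measurable A -> measurable B ->
    forall u, pvm_proj (A `&` B) u = pvm_proj A (pvm_proj B u) ;
  pvm_sigma_additive : forall F : (set R)^nat,
    (forall i, measurable (F i)) -> trivIset setT F ->
    forall u, \sum_(0 <= i < n) pvm_proj (F i) u @[n --> \oo] -->
              pvm_proj (\bigcup_i F i) u }.

(* ||E(B) f||^2 = <E(B) f, f> *)
Definition spectral_measure (R : realType) (H : hilbertType R) (E : pvm H)
    (f : H) (B : set (measurableTypeR R)) : \bar R :=
  (hnorm (E B f) ^+ 2)%:E.

Section spectral_measure_is_measure.
Context (R : realType) (H : hilbertType R) (E : pvm H) (f : H).

Let hnormE (u : H) : (hnorm u)%:C = `|u|.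
Proof. by rewrite RRe_real. Qed.

Let sqr_hnorm (u : H) : (hnorm u ^+ 2)%:C = dot u u.
Proof. by rewrite -sqr_norm_dot -hnormE rmorphXn. Qed.

Let dot_pvm0 (A B : set R) : measurable A -> measurable B -> A `&` B = set0 ->
  dot (E A f) (E B f) = 0.
Proof.
by move=> mA mB AB0; rewrite -pvm_sym// -pvmI// setIC AB0 pvm0 linear0l.
Qed.

Let pythagoras (F : (set R)^nat) : (forall i, measurable (F i)) ->
  trivIset setT F -> forall n,
  hnorm (\sum_(0 <= i < n) E (F i) f) ^+ 2 =
  \sum_(0 <= i < n) hnorm (E (F i) f) ^+ 2.
Proof.
move=> mF tF n; apply: (can_inj (fun x => erefl : complex.Re x%:C = x)).
rewrite sqr_hnorm rmorph_sum/=.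
under [RHS]eq_bigr do rewrite -/(_%:C) sqr_hnorm.
rewrite linear_sumlz/=; apply: eq_big_nat => i /andP[_ ltin].
rewrite linear_sumr/= (bigD1_seq i) ?mem_index_iota ?iota_uniq//=.
rewrite big1 ?addr0// => j ji; apply: dot_pvm0 => //.
by move/trivIsetP : tF; apply => //; rewrite eq_sym.
Qed.

Let mu0 : spectral_measure E f set0 = 0%E.
Proof. by rewrite /spectral_measure pvm0 /hnorm normr0 expr0n. Qed.

Let mu_ge0 (B : set (measurableTypeR R)) : (0 <= spectral_measure E f B)%E.
Proof. by rewrite /spectral_measure lee_fin sqr_ge0. Qed.

Let mu_sigma_additive : semi_sigma_additive (spectral_measure E f).
Proof.
move=> F mF tF mUF; rewrite /spectral_measure.
under eq_fun do rewrite sumEFin -pythagoras//.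
apply: cvg_EFin; first exact: nearW.
apply: (@cvg_comp _ _ _ (fun n => hnorm (\sum_(0 <= i < n) E (F i) f))
  (fun x => x ^+ 2) _ (nbhs (hnorm (E (\bigcup_i F i) f)))); last first.
  exact: exprn_continuous.
have /cvgrPdist_lt cvgF := @pvm_sigma_additive _ _ E F mF tF f.
apply/cvgrPdist_lt => e e0.
have e0C : 0 < e%:C :> R[i] by rewrite ltcR.
near=> n; rewrite -ltcR.
have -> (x : R) : `|x|%:C = `|x%:C| by rewrite normc_def/= expr0n addr0 sqrtr_sqr.
rewrite rmorphB/= !hnormE; apply: le_lt_trans (ler_dist_dist _ _) _.
by near: n; exact: cvgF.
Unshelve. all: by end_near. Qed.

HB.instance Definition _ := isMeasure.Build _ _ _ (spectral_measure E f)
  mu0 mu_ge0 mu_sigma_additive.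

End spectral_measure_is_measure.

Section functional_calculus.
Context (R : realType) (H : hilbertType R) (E : pvm H).

(* The domain of \int phi dE. *)
Definition spectral_dom (phi : R -> R) : set H :=
  [set f | (\int[spectral_measure E f]_l (phi l ^+ 2)%:E < +oo)%E].

(* The n-th Lebesgue sum of \int phi dE, applied to f: the range [-n, n[ of phi
   is cut into intervals of length 2^-n. *)
Definition lebesgue_sum (phi : R -> R) (n : nat) (f : H) : H :=
  \sum_(k < (n * 2 ^ n).*2)
    let c := k%:R / 2 ^+ n - n%:R in
    c%:C *: E [set l | c <= phi l < c + 2 ^- n] f.

(* (\int phi dE) f, meaningful for f in spectral_dom phi *)
Definition spectral_integral (phi : R -> R) (f : H) : H :=
  lim (lebesgue_sum phi n f @[n --> \oo]).

(* L = \int l dE(l): E is the spectral resolution of L given by the spectral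
   theorem, and is determined by L. *)
Definition spectral_resolution (L : operator H) : Prop :=
  op_dom L = spectral_dom id /\
  forall f, op_dom L f -> lebesgue_sum id n f @[n --> \oo] --> L f.

(* In the rest of this file, E is the spectral resolution of a positive
   operator L. *)

(* L^s; its domain is spectral_dom (fun l => l `^ s). *)
Definition op_power (s : R) : H -> H := spectral_integral (fun l => l `^ s).

(* The space H^r and its norm. *)
Definition smooth_space (r : nat) : set H :=
  spectral_dom (fun l => l `^ (r%:R / 2)).

Definition smooth_norm (r : nat) (f : H) : R :=
  hnorm f + hnorm (op_power (r%:R / 2) f).

(* K f t for the couple (H, H^r) *)
Definition K_functional (r : nat) (f : H) (t : R) : R :=
  inf [set x | exists f0 f1 : H, [/\ f = f0 + f1, smooth_space r f1 &
                                     x = hnorm f0 + t * smooth_norm r f1]].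

(* The norm of (H, H^r)^K_{alpha / r, q}, for 0 < alpha < r and q >= 1; it is
   +oo outside of the Besov space. *)
Definition besov_norm (r : nat) (alpha : R) (q : \bar R) (f : H) : \bar R :=
  let theta := alpha / r%:R in
  if q is p%:E then
    ((\int[lebesgue_measure]_(t in `]0%R, +oo[)
        ((t `^ (- theta) * K_functional r f t) `^ p / t)%:E) `^ p^-1)%E
  else
    ereal_sup [set (t `^ (- theta) * K_functional r f t)%:E | t in `]0, +oo[].

(* The range of the spectral projection of sqrt L for [0, omega]. *)
Definition paley_wiener (omega : R) : set H :=
  range (E [set l | 0 <= l /\ Num.sqrt l <= omega]).

Definition best_approximation (f : H) (omega : R) : R :=
  inf [set hnorm (f - g) | g in paley_wiener omega].

Definition approximation_norm (alpha : R) (q : \bar R) (f : H) : \bar R :=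
  let a j := 2 `^ (j%:R * alpha) * best_approximation f (2 ^+ j) in
  ((hnorm f)%:E +
   if q is p%:E then (\sum_(0 <= j <oo) (a j `^ p)%:E) `^ p^-1
   else ereal_sup (range (fun j => (a j)%:E)))%E.

End functional_calculus.

(* Main.v *)
From HB Require Import structures.
Require Import Defs.
From mathcomp Require Import all_boot all_order all_algebra.
From mathcomp Require Import complex.
From mathcomp Require Import all_classical all_reals all_analysis.
From mathcomp Require Import sesquilinear measurable_realfun ring lra.
Import Order.TTheory GRing.Theory Num.Theory.
Import numFieldNormedType.Exports.
Local Open Scope classical_set_scope.
Local Open Scope ring_scope.

(** Everything is reduced to the scalar measures [mu_f(A) = |E(A) f|^2].  The
Lebesgue sums of [phi] are simple spectral operators, and the simple spectral
calculus is isometric from [L^2(mu_f)] to [H]; by dominated convergence the sums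
converge on the natural domain and [|(\int phi dE) f|^2 = \int phi^2 dmu_f]
([hnorm_spectral_integral]).  Positivity of [L] forces [E] to vanish on the
negative half-line ([pvm_negative]).

Write [P_j] for the projection onto the Paley-Wiener space of bandwidth [2^j],
[e_j = |f - P_j f|] (which is the best approximation error, the projection being
orthogonal), [B = 2^r], and [K(t)] for the K-functional of [f].  The two
classical inequalities of approximation theory are read off [\int phi^2 dmu_f]
with [phi(l) = l^(r/2)], because [phi >= B^j] outside of the band and
[phi <= B^j] inside:
- Jackson: [B^j |g - P_j g| <= |L^(r/2) g|].  Splitting [f = f0 + f1] gives
  [e_j <= K(B^-j)].
- Bernstein: the [H^r]-norm of [P_(j+1) f] exceeds that of [P_j f] by at most
  [2 B^(j+1) e_j].  The splitting [f = (f - P_j f) + P_j f] then gives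
  [K(B^-j) <= e_j + B^-j M_j] with [M_(j+1) <= M_j + 2 B^(j+1) e_j].

What remains concerns real sequences.  Let [A = B^theta = 2^alpha].  On the cell
[]B^-j, B B^-j]] the function [t^-theta K(t)] is comparable to [b_j = A^j K(B^-j)]
since [K] is nondecreasing and [K(B t) <= B K(t)], and [dt/t] has mass
comparable to 1; beyond [B], [K] is bounded by [|f|] and [t^-theta] decays
geometrically.  Hence the Besov norm is comparable to [|f|] plus the
[l^q]-norm of [b].  Jackson bounds [a_j = A^j e_j] by [b_j].  Conversely
[b_j <= a_j + w_j], where [w_j = (A/B)^j M_j] satisfies
[w_(j+1) <= (A/B) w_j + 2 A a_j]; as [A < B], i.e. [alpha < r], this linear
recursion is a contraction and the [l^q]-norm of [w] is controlled by that of
[a] and by [|f|] ([sum_powR_recursion], [sup_recursion]). *)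

Set Implicit Arguments.
Unset Strict Implicit.
Unset Printing Implicit Defensive.

(** * The real-valued norm *)

Section hilbert_norm.
Context {R : realType} {H : hilbertType R}.
Implicit Types u v : H.

Lemma hnormE u : (hnorm u)%:C%C = `|u|.
Proof. by rewrite RRe_real. Qed.

Lemma sqr_hnorm u : (hnorm u ^+ 2)%:C%C = dot u u.
Proof. by rewrite -sqr_norm_dot -hnormE rmorphXn. Qed.

Lemma hnorm_ge0 u : 0 <= hnorm u.
Proof. by rewrite -lecR hnormE; exact: normr_ge0. Qed.

Lemma hnorm0 : hnorm (0 : H) = 0.
Proof. by rewrite /hnorm normr0. Qed.

Lemma hnorm_eq0 u : hnorm u = 0 -> u = 0.
Proof. by move=> u0; apply/eqP; rewrite -normr_eq0 -hnormE u0. Qed.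

Lemma ler_hnormD u v : hnorm (u + v) <= hnorm u + hnorm v.
Proof. by rewrite -lecR rmorphD/= !hnormE ler_normD. Qed.

Lemma ler_dist_hnorm u v : `|hnorm u - hnorm v| <= hnorm (u - v).
Proof.
have normC (x : R) : `|x|%:C%C = `|x%:C%C|.
  by rewrite normc_def/= expr0n addr0 sqrtr_sqr.
by rewrite -lecR normC rmorphB/= !hnormE ler_dist_dist.
Qed.

Lemma cvg_hnorm (u_ : nat -> H) u :
  u_ n @[n --> \oo] --> u -> hnorm (u_ n) @[n --> \oo] --> hnorm u.
Proof.
move=> /cvgrPdist_lt cvgu; apply/cvgrPdist_lt => e e0.
have e0C : 0 < e%:C%C :> R[i] by rewrite ltcR.
near=> n; apply: le_lt_trans (ler_dist_hnorm _ _) _.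
by rewrite -ltcR hnormE; near: n; exact: cvgu.
Unshelve. all: by end_near. Qed.

End hilbert_norm.

(** * Simple spectral calculus *)

Section finite_spectral_measure.
Context {R : realType} {H : hilbertType R} (E : pvm H) (f : H).

Let spectral_measure_fin : fin_num_fun (spectral_measure E f).
Proof. by move=> A mA; rewrite /spectral_measure. Qed.

HB.instance Definition _ := Measure_isFinite.Build _ _ _
  (spectral_measure E f) spectral_measure_fin.

End finite_spectral_measure.

Section simple_calculus.
Context {R : realType} {H : hilbertType R} (E : pvm H).
Implicit Types (f g : H) (A B : set R) (s t : seq (R * set R)).

Local Notation mu f := (spectral_measure E f).

Lemma dot_pvm A B f : measurable A -> measurable B ->
  dot (E A f) (E B f) = (hnorm (E (A `&` B) f) ^+ 2)%:C%C.
Proof.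
move=> mA mB; have mAB := measurableI _ _ mA mB.
by rewrite sqr_hnorm !pvm_sym// -!pvmI// setIid.
Qed.

Lemma pvmB A f g : measurable A -> E A (f - g) = E A f - E A g.
Proof. by move=> mA; rewrite addrC -scaleN1r pvm_linear// scaleN1r addrC. Qed.

(** Simple functions are encoded by sequences of pairs (coefficient, set) whose
sets may overlap: differences are then mere concatenations. *)
Definition simple_fun s (l : R) : R := \sum_(p <- s) p.1 * \1_(p.2) l.

Definition simple_op s f : H := \sum_(p <- s) p.1%:C%C *: E p.2 f.

Definition measurable_family s := forall p, p \in s -> measurable p.2.

Lemma measurable_family_cons p s : measurable_family (p :: s) ->
  measurable p.2 /\ measurable_family s.
Proof.
move=> ms; split; first by apply: ms; rewrite mem_head.
by move=> q qs; apply: ms; rewrite inE qs orbT.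
Qed.

Lemma measurable_family_cat s t : measurable_family s -> measurable_family t ->
  measurable_family (s ++ t).
Proof. by move=> ms mt p; rewrite mem_cat => /orP[/ms|/mt]. Qed.

Lemma integrable_simple_fun s f : measurable_family s ->
  (mu f).-integrable setT (fun l => (simple_fun s l)%:E).
Proof.
elim: s => [|p s IH] ms.
  under eq_fun do rewrite /simple_fun big_nil.
  exact: integrable0.
have [mp /IH {}IH] := measurable_family_cons ms.
under eq_fun do rewrite /simple_fun big_cons EFinD EFinM.
by apply: integrableD => //; apply: integrableZl => //; exact: integrable_indic.
Qed.

Lemma integral_simple_fun s f : measurable_family s ->
  (\int[mu f]_l (simple_fun s l)%:E =
   (\sum_(p <- s) p.1 * hnorm (E p.2 f) ^+ 2)%:E)%E.
Proof.
elim: s => [|p s IH] ms.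
  under eq_integral do rewrite /simple_fun big_nil.
  by rewrite integral0 big_nil.
have [mp ms'] := measurable_family_cons ms.
under eq_integral do rewrite /simple_fun big_cons EFinD EFinM.
have ip := integrable_indic (mu f) mp.
rewrite integralD//; last 2 first.
- exact: integrableZl.
- exact: integrable_simple_fun.
rewrite integralZl// integral_indic// setIT.
by rewrite [X in (_ + X)%E](IH ms') big_cons EFinD.
Qed.

(** Expanding the square, the cross terms [dot (E A f) (E B f)] are
[mu f (A `&` B)] by [dot_pvm], which are also the integrals of the products of
indicators. *)
Lemma hnorm_simple_op s f : measurable_family s ->
  ((hnorm (simple_op s f) ^+ 2)%:E = \int[mu f]_l (simple_fun s l ^+ 2)%:E)%E.
Proof.
move=> ms; pose t := [seq (p.1 * q.1, p.2 `&` q.2) | p <- s, q <- s].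
have mt : measurable_family t.
  by move=> _ /allpairsP[[p q] /= [ps qs ->]]; apply: measurableI; exact: ms.
transitivity (\int[mu f]_l (simple_fun t l)%:E)%E; last first.
  apply: eq_integral => l _; congr EFin.
  rewrite /simple_fun big_allpairs_dep expr2 big_distrlr/=.
  apply: eq_bigr => p _; apply: eq_bigr => q _.
  by rewrite indicI mulrACA.
rewrite integral_simple_fun//; congr EFin.
apply: (can_inj (fun x => erefl : complex.Re x%:C%C = x)).
rewrite sqr_hnorm /simple_op big_allpairs_dep rmorph_sum/= linear_sumlz/=.
rewrite big_seq [RHS]big_seq; apply: eq_bigr => p ps.
rewrite rmorph_sum/= linear_sumr/=.
rewrite big_seq [RHS]big_seq; apply: eq_bigr => q qs.
rewrite linearZl_LR/= linearZr_LR/= dot_pvm; [|exact: ms|exact: ms].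
by rewrite conj_Creal ?complex_real// -!rmorphM/= mulrA.
Qed.

End simple_calculus.

(** * Isometry of the spectral integral *)

Section lebesgue_sums.
Context {R : realType} {H : hilbertType R} (E : pvm H).
Implicit Types (f g : H) (phi : R -> R).

Local Notation mu f := (spectral_measure E f).

Definition lebesgue_family phi n : seq (R * set R) :=
  [seq (let c := k%:R / 2 ^+ n - n%:R in (c, [set l | c <= phi l < c + 2 ^- n]))
    | k : 'I_(n * 2 ^ n).*2].

Lemma lebesgue_sumE phi n f :
  lebesgue_sum E phi n f = simple_op E (lebesgue_family phi n) f.
Proof. by rewrite /simple_op big_image. Qed.

Lemma measurable_lebesgue_family phi n : measurable_fun setT phi ->
  measurable_family (lebesgue_family phi n).
Proof.
move=> mphi p /mapP[k _ ->] /=; set c := _ - _.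
rewrite (_ : [set l | _] = setT `&` phi @^-1` `[c, c + 2 ^- n[); last first.
  by rewrite setTI; apply/seteqP; split=> l; rewrite /= in_itv.
exact: mphi.
Qed.

(** The half-open cells of length [2 ^- n] that meet [phi l] reduce to the one
indexed by the integer part of [(phi l + n) * 2 ^+ n]; there is none when this
index is out of range. *)
Lemma simple_fun_lebesgue_family phi n l (x := (phi l + n%:R) * 2 ^+ n) :
  simple_fun (lebesgue_family phi n) l =
  if (0 <= x) && (Num.trunc x < (n * 2 ^ n).*2)%N
  then (Num.trunc x)%:R / 2 ^+ n - n%:R else 0.
Proof.
have p2 : 0 < (2 : R) ^+ n by rewrite exprn_gt0.
have phiE : phi l = x / 2 ^+ n - n%:R by rewrite mulfK ?gt_eqF// addrK.
have cellE (k : nat) : (k%:R / 2 ^+ n - n%:R <= phi l <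
    k%:R / 2 ^+ n - n%:R + 2 ^- n) = (k%:R <= x < k.+1%:R).
  rewrite [X in _ < X](_ : _ = k.+1%:R / 2 ^+ n - n%:R); last first.
    by rewrite -(natr1 k) mulrDl mul1r addrAC.
  rewrite phiE lerD2r ltrD2r.
  by rewrite ler_pM2r ?ltr_pM2r ?invr_gt0.
have indE (k : nat) (c := k%:R / 2 ^+ n - n%:R) :
    \1_[set l | c <= phi l < c + 2 ^- n] l = (k%:R <= x < k.+1%:R)%R%:R :> R.
  by rewrite indicE mem_setE -cellE.
rewrite /simple_fun big_image/=; under eq_bigr do rewrite indE.
have [x0|x0] /= := leP 0 x; last first.
  apply: big1 => k _.
  rewrite (_ : _ && _ = false) ?mulr0//; apply/negbTE.
  by rewrite negb_and -ltNge (lt_le_trans x0).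
case: ifP => [kN|/negbT kN].
  rewrite (bigD1 (Ordinal kN))//= big1 ?addr0 => [|k].
    by rewrite -truncn_eq// eqxx mulr1.
  rewrite -val_eqE/= => kx.
  by rewrite -truncn_eq// eq_sym (negbTE kx) mulr0.
apply: big1 => k _; rewrite -truncn_eq//.
by rewrite (_ : _ == _ = false) ?mulr0//; apply: contraNF kN => /eqP ->.
Qed.

Lemma lebesgue_family_round phi n l : `|phi l| < n%:R ->
  `|simple_fun (lebesgue_family phi n) l - phi l| <= 2 ^- n.
Proof.
rewrite simple_fun_lebesgue_family ltr_norml => /andP[nphi phin].
have p2 : 0 < (2 : R) ^+ n by rewrite exprn_gt0.
set x := _ * _.
have phiE : phi l = x / 2 ^+ n - n%:R by rewrite mulfK ?gt_eqF// addrK.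
have x0 : 0 <= x by rewrite mulr_ge0 ?(ltW p2)//; lra.
have /andP[tx xt] := truncn_itv x0.
rewrite x0/= ifT; last first.
  rewrite -(ltr_nat R) (le_lt_trans tx)// -muln2 natrM natrM natrX.
  by rewrite mulrAC ltr_pM2r// mulr_natr mulr2n; lra.
rewrite phiE opprB addrA subrK -mulrBl normrM (gtr0_norm (x := _^-1)) ?invr_gt0//.
rewrite -[leRHS]mul1r ler_pM2r ?invr_gt0// distrC ger0_norm ?subr_ge0//.
by move: xt; rewrite -(natr1 (Num.trunc x)); lra.
Qed.

(** A bound uniform in [n], which is what dominated convergence needs. *)
Lemma lebesgue_family_dist phi n l :
  `|simple_fun (lebesgue_family phi n) l - phi l| <= `|phi l| + 1.
Proof.
have [phin|phin] := ltP `|phi l| n%:R.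
  rewrite (le_trans (lebesgue_family_round phin))//.
  by rewrite (@le_trans _ _ 1) ?invf_le1 ?exprn_gt0 ?exprn_ege1 ?ler1n// lerDr.
rewrite simple_fun_lebesgue_family; set x := _ * _.
have p2 : 0 < (2 : R) ^+ n by rewrite exprn_gt0.
case: ifP => [/andP[x0 xN]|_]; last by rewrite sub0r normrN lerDl.
(* the one value of modulus at least n that lies in [-n, n[ is -n itself *)
suff : phi l = - n%:R.
  move=> phiE; rewrite /x phiE addNr mul0r.
  by rewrite truncn0 mul0r sub0r subrr normr0 addr_ge0.
have nphi : - n%:R <= phi l.
  by move: x0; rewrite pmulr_lge0//; lra.
move: phin; rewrite ler_normr => /orP[phin|]; last by lra.
exfalso; move: xN; apply/negP; rewrite -leqNgt truncn_ge_nat//.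
rewrite -muln2 natrM natrM natrX mulrAC ler_pM2r// mulr_natr mulr2n; lra.
Qed.

Lemma lebesgue_family_le0 phi n l :
  phi l <= 0 -> simple_fun (lebesgue_family phi n) l <= 0.
Proof.
move=> phi0; rewrite simple_fun_lebesgue_family; set x := _ * _.
have p2 : 0 < (2 : R) ^+ n by rewrite exprn_gt0.
case: ifP => [/andP[x0 _]|//].
have /andP[tx _] := truncn_itv x0.
by rewrite subr_le0 ler_pdivrMr// (le_trans tx)// ler_pM2r//; lra.
Qed.

Lemma lebesgue_family_cvg phi l :
  simple_fun (lebesgue_family phi n) l @[n --> \oo] --> phi l.
Proof.
apply/cvgrPdist_lt => e e0.
near=> n; rewrite distrC; apply: (@le_lt_trans _ _ (2 ^- n)).
  by apply: lebesgue_family_round; near: n; exact: nbhs_infty_gtr.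
near: n.
have /cvgrPdist_lt/(_ e e0) : geometric 1 2^-1 @ \oo --> (0 : R).
  by apply: cvg_geometric; rewrite ger0_norm// invf_lt1// ltr1n.
apply: filterS => n; rewrite /geometric/= mul1r sub0r normrN exprVn.
by rewrite ger0_norm// invr_ge0 exprn_ge0.
Unshelve. all: by end_near. Qed.

End lebesgue_sums.

Section spectral_isometry.
Context {R : realType} {H : hilbertType R} (E : pvm H).
Context (phi : R -> R) (mphi : measurable_fun setT phi) (f : H).
Hypothesis phif : spectral_dom E phi f.

Local Notation mu := (spectral_measure E f).
Local Notation psi n := (simple_fun (lebesgue_family phi n)).

Let mpsi n : measurable_fun [set: measurableTypeR R] (psi n).
Proof.
apply/measurable_EFinP.
have mfam := measurable_lebesgue_family (n := n) mphi.
by have /integrableP[] := integrable_simple_fun E f mfam.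
Qed.

(* spectral_measure E f is finite, so constants are integrable *)
Let integrable_majorant (a b : R) : mu.-integrable setT
  (fun l => (a * phi l ^+ 2 + b)%:E).
Proof.
under eq_fun do rewrite EFinD EFinM.
apply: integrableD => //; last exact: (finite_measure_integrable_cst mu b).
apply: integrableZl => //; apply/integrableP; split.
  by apply/measurable_EFinP; exact: measurable_funX.
by under eq_integral do rewrite gee0_abs ?lee_fin ?sqr_ge0//.
Qed.

(* |psi n| <= 2 |phi| + 1, hence the dominating function 8 phi^2 + 2 *)
Let psi_sqr_cvg : (\int[mu]_l (psi n l ^+ 2)%:E)%E @[n --> \oo] -->
  (\int[mu]_l (phi l ^+ 2)%:E)%E.
Proof.
apply: (@dominated_cvg _ _ _ mu setT measurableT (fun n l => (psi n l ^+ 2)%:E)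
  (fun l => (phi l ^+ 2)%:E) (fun l => (8 * phi l ^+ 2 + 2)%:E)) => //.
- by move=> n; apply/measurable_EFinP; exact: measurable_funX.
- move=> l _; apply: cvg_EFin; first exact: nearW.
  apply: (@cvg_comp _ _ _ (fun n => psi n l) (fun x => x ^+ 2) _ (nbhs (phi l))).
    exact: lebesgue_family_cvg.
  exact: exprn_continuous.
- move=> n l _; rewrite lee_fin ger0_norm ?sqr_ge0//.
  have := lebesgue_family_dist phi n l; rewrite ler_norml => /andP[].
  rewrite -real_normK ?num_real// -[phi l ^+ 2]real_normK ?num_real//.
  have := ler_norm (phi l); have := ler_norm (- phi l); rewrite normrN.
  have := lebesgue_family_dist phi n l.
  have := ler_normD (psi n l - phi l) (phi l); rewrite subrK.
  have := normr_ge0 (psi n l).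
  set a := `|psi n l|; set b := `|phi l|; set c := `|_ - _| => a0 ac cb _ _ _ _.
  have b0 : 0 <= b by exact: normr_ge0.
  have : a ^+ 2 <= (2 * b + 1) ^+ 2 by rewrite lerXn2r// ?nnegrE; lra.
  have : 0 <= (2 * b - 1) ^+ 2 by exact: sqr_ge0.
  rewrite !expr2; nra.
Qed.

(* |psi n - phi| <= |phi| + 1, hence the dominating function 2 phi^2 + 2 *)
Let psi_dist_cvg :
  (\int[mu]_l ((psi n l - phi l) ^+ 2)%:E)%E @[n --> \oo] --> 0%E.
Proof.
rewrite -(integral0 mu setT).
apply: (@dominated_cvg _ _ _ mu setT measurableT
  (fun n l => ((psi n l - phi l) ^+ 2)%:E) (cst 0%E)
  (fun l => (2 * phi l ^+ 2 + 2)%:E)) => //.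
- move=> n; apply/measurable_EFinP; apply: measurable_funX.
  exact: measurable_funB.
- move=> l _; rewrite (_ : cst 0%E l = ((phi l - phi l) ^+ 2)%:E); last first.
    by rewrite subrr expr0n.
  apply: cvg_EFin; first exact: nearW.
  apply: (@cvg_comp _ _ _ (fun n => psi n l - phi l) (fun x => x ^+ 2) _
    (nbhs (phi l - phi l))).
    by apply: cvgB; [exact: lebesgue_family_cvg|exact: cvg_cst].
  exact: exprn_continuous.
- move=> n l _; rewrite lee_fin ger0_norm ?sqr_ge0//.
  have := lebesgue_family_dist phi n l.
  rewrite -real_normK ?num_real// -[phi l ^+ 2]real_normK ?num_real//.
  have : 0 <= `|psi n l - phi l| by exact: normr_ge0.
  set b := `|phi l|; set c := `|_ - _| => c0 cb.
  have b0 : 0 <= b by exact: normr_ge0.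
  have : c ^+ 2 <= (b + 1) ^+ 2 by rewrite lerXn2r// ?nnegrE; lra.
  have : 0 <= (b - 1) ^+ 2 by exact: sqr_ge0.
  rewrite !expr2; nra.
Qed.

Let hnorm_lebesgue_sumB m n :
  ((hnorm (lebesgue_sum E phi m f - lebesgue_sum E phi n f) ^+ 2)%:E <=
   2%:E * \int[mu]_l ((psi m l - phi l) ^+ 2)%:E +
   2%:E * \int[mu]_l ((psi n l - phi l) ^+ 2)%:E)%E.
Proof.
pose s := lebesgue_family phi m ++
  [seq (- p.1, p.2) | p <- lebesgue_family phi n].
have sopE : simple_op E s f = lebesgue_sum E phi m f - lebesgue_sum E phi n f.
  rewrite !lebesgue_sumE /simple_op big_cat/=; congr (_ + _).
  by rewrite big_map -sumrN; apply: eq_bigr => p _; rewrite rmorphN scaleNr.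
have sfunE l : simple_fun s l = psi m l - psi n l.
  rewrite /simple_fun big_cat/=; congr (_ + _).
  by rewrite big_map -sumrN; apply: eq_bigr => p _; rewrite mulNr.
have ms : measurable_family s.
  apply: measurable_family_cat; first exact: measurable_lebesgue_family.
  by move=> p /mapP[q /(measurable_lebesgue_family mphi) + ->].
have md k : measurable_fun [set: measurableTypeR R]
    (fun l => ((psi k l - phi l) ^+ 2)%:E).
  by apply/measurable_EFinP; apply: measurable_funX; exact: measurable_funB.
rewrite -sopE hnorm_simple_op// -!ge0_integralZl//; last 2 first.
- by move=> l _; rewrite lee_fin sqr_ge0.
- by move=> l _; rewrite lee_fin sqr_ge0.
rewrite -ge0_integralD//; last 4 first.
- by move=> l _; rewrite -EFinM lee_fin mulr_ge0// sqr_ge0.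
- exact: measurable_funeM.
- by move=> l _; rewrite -EFinM lee_fin mulr_ge0// sqr_ge0.
- exact: measurable_funeM.
apply: ge0_le_integral => //.
- by move=> l _; rewrite lee_fin sqr_ge0.
- apply/measurable_EFinP; apply: measurable_funX.
  rewrite (_ : simple_fun s = fun l => psi m l - psi n l); last exact/funext.
  exact: measurable_funB.
- by apply: emeasurable_funD; exact: measurable_funeM.
- move=> l _; rewrite -!EFinM -EFinD lee_fin sfunE.
  have := sqr_ge0 ((psi m l - phi l) + (psi n l - phi l)).
  rewrite !expr2; lra.
Qed.

(** By the simple isometry the Lebesgue sums are Cauchy in [H] because the rounded
functions are Cauchy in the [L^2] space of [mu]. *)
Lemma is_cvg_lebesgue_sum : cvg (lebesgue_sum E phi n f @[n --> \oo]).
Proof.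
apply: cauchy_cvg; apply: cauchy_exP => e e0.
have eE : e = (complex.Re e)%:C%C by rewrite RRe_real// gtr0_real.
have eR0 : 0 < complex.Re e by rewrite -ltcR -eE.
have d0 : (0 < (complex.Re e ^+ 2 / 4)%:E)%E.
  by rewrite lte_fin divr_gt0// exprn_gt0.
have [N _ small] := @psi_dist_cvg _ (open_ereal_lt' d0).
exists (lebesgue_sum E phi N f), N => // n Nn; rewrite -ball_normE/=.
rewrite eE -hnormE ltcR -(@ltr_pXn2r _ 2)// ?nnegrE ?hnorm_ge0 ?(ltW eR0)//.
rewrite -lte_fin (le_lt_trans (hnorm_lebesgue_sumB _ _))//.
apply: (@lt_le_trans _ _ (2%:E * (complex.Re e ^+ 2 / 4)%:E +
                          2%:E * (complex.Re e ^+ 2 / 4)%:E)%E); last first.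
  by rewrite -!EFinM -EFinD lee_fin; lra.
by apply: lteD; rewrite lte_pmul2l ?lte_fin//; apply: small => /=.
Qed.

Lemma hnorm_spectral_integral :
  ((hnorm (spectral_integral E phi f) ^+ 2)%:E =
   \int[mu]_l (phi l ^+ 2)%:E)%E.
Proof.
have sumE n : ((hnorm (lebesgue_sum E phi n f) ^+ 2)%:E =
    \int[mu]_l (psi n l ^+ 2)%:E)%E.
  by rewrite lebesgue_sumE hnorm_simple_op//; exact: measurable_lebesgue_family.
apply: (cvg_unique _ _ psi_sqr_cvg) => //; rewrite -(funext sumE).
apply: cvg_EFin; first exact: nearW.
apply: (@cvg_comp _ _ _ (fun n => hnorm (lebesgue_sum E phi n f))
  (fun x => x ^+ 2) _ (nbhs (hnorm (spectral_integral E phi f)))); last first.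
  exact: exprn_continuous.
exact: cvg_hnorm is_cvg_lebesgue_sum.
Qed.

End spectral_isometry.

(** * Spectral projections and best approximation *)

Section spectral_projections.
Context {R : realType} {H : hilbertType R} (E : pvm H).
Implicit Types (f g : H) (A B : set R).

Local Notation mu f := (spectral_measure E f).

(** The measure of [E A f] is the restriction to [A] of the measure of [f]. *)
Lemma integral_spectral_measure_pvm A f (h : R -> R) :
  measurable A -> measurable_fun setT h -> (forall l, 0 <= h l) ->
  (\int[mu (E A f)]_l (h l)%:E = \int[mu f]_(l in A) (h l)%:E)%E.
Proof.
move=> mA mh h0.
rewrite (@ge0_negligible_integral _ (measurableTypeR R) R (mu (E A f))
  setT (~` A))//.
- rewrite setDE setCK setTI; apply: eq_measure_integral => B mB BA.
  by rewrite /= /spectral_measure -pvmI// setIidl.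
- exact: measurableC.
- exact/measurable_EFinP.
- by move=> l _; rewrite lee_fin.
- rewrite /= /spectral_measure -pvmI; [|exact: measurableC|exact: mA].
  by rewrite setICl pvm0 hnorm0 expr0n.
Qed.

(** [f - E A f] is the simple operator of [1 - \1_A], the indicator of the
complement. *)
Lemma sqr_hnorm_subr_pvm A f : measurable A ->
  hnorm (f - E A f) ^+ 2 = hnorm (E (~` A) f) ^+ 2.
Proof.
move=> mA; pose s : seq (R * set R) := [:: (1, setT); (-1, A)].
have ms : measurable_family s.
  by move=> p; rewrite !inE => /orP[] /eqP ->//; exact: measurableT.
have -> : f - E A f = simple_op E s f.
  by rewrite /simple_op big_cons big_seq1/= rmorphN scaleNr !scale1r pvmT.
apply/EFin_inj; rewrite hnorm_simple_op//.
transitivity (\int[mu f]_l (\1_(~` A) l)%:E)%E.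
  apply: eq_integral => l _; congr EFin.
  rewrite /simple_fun big_cons big_seq1/= !indicE in_setT in_setC mul1r mulN1r.
  by case: (l \in A); rewrite /= ?subrr ?subr0 ?expr0n ?expr1n.
by rewrite integral_indic ?setIT//; exact: measurableC.
Qed.

Lemma ler_hnorm_pvm A f : measurable A -> hnorm (E A f) <= hnorm f.
Proof.
move=> mA; rewrite -(@ler_pXn2r _ 2)// ?nnegrE ?hnorm_ge0//.
rewrite -lee_fin -[in leRHS](pvmT E f).
by apply: (@le_measure _ _ _ (mu f)); rewrite ?inE.
Qed.

Lemma ler_hnorm_pvmS A B f : measurable A -> measurable B -> A `<=` B ->
  hnorm (E A f) <= hnorm (E B f).
Proof.
by move=> mA mB AB; rewrite -(setIidl AB) pvmI// ler_hnorm_pvm.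
Qed.

Lemma ler_hnorm_subr_pvm A f : measurable A -> hnorm (f - E A f) <= hnorm f.
Proof.
move=> mA; rewrite -(@ler_pXn2r _ 2)// ?nnegrE ?hnorm_ge0//.
rewrite sqr_hnorm_subr_pvm// lerXn2r ?nnegrE ?hnorm_ge0//.
exact/ler_hnorm_pvm/measurableC.
Qed.

(** For [g] in the range of [E A], the contraction [id - E A] maps [f - g] to
[f - E A f]. *)
Lemma inf_dist_range_pvm A f : measurable A ->
  inf [set hnorm (f - g) | g in range (E A)] = hnorm (f - E A f).
Proof.
move=> mA; apply/eqP; rewrite eq_le; apply/andP; split.
  apply: ge_inf; last by exists (E A f) => //; exists f.
  by exists 0 => _ [g _ <-]; exact: hnorm_ge0.
apply: lb_le_inf; first by exists (hnorm (f - E A f)), (E A f) => //; exists f.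
move=> _ [_ [h _ <-] <-]; apply: le_trans (ler_hnorm_subr_pvm _ mA).
by rewrite pvmB// -pvmI// setIid opprB addrA subrK.
Qed.

Lemma ltr_hnorm_polarization (u v : H) : 0 < dot u v ->
  hnorm (u - v) < hnorm (u + v).
Proof.
move=> uv0; rewrite -(@ltr_pXn2r _ 2)// ?nnegrE ?hnorm_ge0// -ltcR !sqr_hnorm.
rewrite linearBl/= !linearBr/= linearDl/= !linearDr/=.
have -> : dot v u = dot u v.
  by rewrite hermC expr0 mul1r; apply: conj_Creal; exact: gtr0_real.
rewrite -subr_gt0.
suff -> : forall a b c : R[i], a + b + (b + c) - (a - b - (b - c)) = 4 * b.
  by rewrite mulr_gt0.
by move=> a b c; ring.
Qed.

End spectral_projections.

(** * Nonnegativity of the spectrum *)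

Section nonnegative_spectrum.
Context {R : realType} {H : hilbertType R} (E : pvm H) (L : operator H).
Hypotheses (Lpos : positive_definite L) (EL : spectral_resolution E L).
Implicit Types f : H.

Local Notation mu f := (spectral_measure E f).

(* A nonzero g in the range of E [-k, 0[ would lie in the domain of L, with
   0 < dot (L g) g, that is |L g - g| < |L g + g| by polarization.  But the Lebesgue
   sums psi of l are nonpositive on [-k, 0[, so that (psi + 1)^2 <= (psi - 1)^2
   there, and the isometry yields the opposite inequality in the limit. *)
Let pvm_bounded_negative (k : nat) f : E `[- k%:R, 0[%classic f = 0.
Proof.
set A : set R := [set` _]; have mA : measurable A by exact: measurable_itv.
set g := E A f; apply: contrapT => /eqP g0.
have gdom : op_dom L g.
  rewrite EL.1 /spectral_dom/= integral_spectral_measure_pvm//; last first.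
    by move=> l; exact: sqr_ge0.
  apply: (@le_lt_trans _ _ (\int[mu f]_(l in A) ((k%:R : R) ^+ 2)%:E)%E).
    apply: ge0_le_integral => //.
    - by move=> l _; rewrite lee_fin sqr_ge0.
    - by apply/measurable_EFinP; exact: exprn_measurable.
    - move=> l; rewrite /A/= in_itv/= => /andP[kl l0].
      by rewrite lee_fin -(sqrrN l) lerXn2r ?nnegrE//; lra.
  by rewrite integral_cst// -EFinM ltry.
have := ltr_hnorm_polarization (Lpos gdom g0); rewrite ltNge => /negP; apply.
have cvgL := EL.2 _ gdom.
have le_sum n :
    hnorm (lebesgue_sum E id n g + g) <= hnorm (lebesgue_sum E id n g - g).
  pose s (c : R) := lebesgue_family (id : R -> R) n ++ [:: (c, setT)].
  have ms c : measurable_family (s c).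
    apply: measurable_family_cat; first exact: measurable_lebesgue_family.
    by move=> p; rewrite inE => /eqP ->; exact: measurableT.
  have sopE c : simple_op E (s c) g = lebesgue_sum E id n g + c%:C%C *: g.
    by rewrite lebesgue_sumE /simple_op big_cat big_seq1/= pvmT.
  have sfunE c l : simple_fun (s c) l = simple_fun (lebesgue_family id n) l + c.
    by rewrite /simple_fun big_cat big_seq1/= indicT mulr1.
  have msq c : measurable_fun [set: measurableTypeR R]
      (fun l => simple_fun (s c) l ^+ 2).
    apply: measurable_funX; apply/measurable_EFinP.
    by have /integrableP[] := integrable_simple_fun E f (ms c).
  have <- : simple_op E (s 1) g = lebesgue_sum E id n g + g.
    by rewrite sopE scale1r.
  have <- : simple_op E (s (- 1)) g = lebesgue_sum E id n g - g.
    by rewrite sopE rmorphN scaleN1r.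
  rewrite -(@ler_pXn2r _ 2)// ?nnegrE ?hnorm_ge0// -lee_fin !hnorm_simple_op//.
  rewrite !(integral_spectral_measure_pvm E f mA (msq _) (fun=> sqr_ge0 _)).
  apply: ge0_le_integral => //.
  - by move=> l _; rewrite lee_fin sqr_ge0.
  - by apply/measurable_EFinP; exact: measurable_funTS (msq _).
  - by apply/measurable_EFinP; exact: measurable_funTS (msq _).
  move=> l; rewrite /A/= in_itv/= => /andP[_ l0]; rewrite lee_fin !sfunE.
  have := @lebesgue_family_le0 R id n l (ltW l0).
  by rewrite !expr2; lra.
apply: (ler_cvg_to (cvg_hnorm (cvgD cvgL (cvg_cst g)))
  (cvg_hnorm (cvgB cvgL (cvg_cst g)))); exact: nearW.
Qed.

(** Countable union of the bounded pieces. *)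
Lemma pvm_negative f : E `]-oo, 0[%classic f = 0.
Proof.
have N (k : nat) :
    (mu f).-negligible (`[- k%:R, 0[%classic : set (measurableTypeR R)).
  apply/negligibleP; first exact: measurable_itv.
  by rewrite /= /spectral_measure pvm_bounded_negative hnorm0 expr0n.
have /negligible_bigcup := N.
rewrite (_ : \bigcup_k _ = `]-oo, 0[%classic); last first.
  apply/seteqP; split=> l /=.
    by move=> [k _] /=; rewrite !in_itv/= => /andP[].
  rewrite in_itv/= => l0; exists (Num.trunc (- l)).+1 => //=.
  have /andP[_] := @truncn_itv _ (- l) ltac:(lra).
  by rewrite in_itv/= l0 andbT; lra.
move/negligibleP => /(_ (measurable_itv _)); rewrite /= /spectral_measure => -[].
by move/eqP; rewrite sqrf_eq0 => /eqP/hnorm_eq0.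
Qed.

End nonnegative_spectrum.

(** * Jackson and Bernstein inequalities *)

Section jackson_bernstein.
Context {R : realType} {H : hilbertType R} (E : pvm H).
Hypothesis E_neg : forall f, E `]-oo, 0[%classic f = 0.
Variable r : nat.
Implicit Types (f g : H) (A : set R) (j : nat).

Local Notation mu f := (spectral_measure E f).
Local Notation B := (2 ^+ r : R).

Definition dyadic_band j : set R := [set l | 0 <= l /\ Num.sqrt l <= 2 ^+ j].

Definition dyadic_proj j f : H := E (dyadic_band j) f.

(* L^(r/2) is the spectral integral of phi *)
Let phi (l : R) := l `^ (r%:R / 2).

Let phiE l : 0 <= l -> phi l = Num.sqrt l ^+ r.
Proof.
by move=> l0; rewrite /phi mulrC powRrM powR12_sqrt// powR_mulrn// sqrtr_ge0.
Qed.

Let mphi : measurable_fun setT phi. Proof. exact: measurable_powR. Qed.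

Let mphi2 D : measurable_fun D (fun l : measurableTypeR R => (phi l ^+ 2)%:E).
Proof. by apply/measurable_EFinP/measurable_funTS; exact: measurable_funX. Qed.

Let phi2_ge0 l : (0 <= (phi l ^+ 2)%:E)%E.
Proof. by rewrite lee_fin sqr_ge0. Qed.

Lemma measurable_dyadic_band j : measurable (dyadic_band j).
Proof.
rewrite (_ : dyadic_band j = `[0, (2 ^+ j) ^+ 2]%classic); last first.
  apply/seteqP; split=> l /=; rewrite in_itv/=.
    move=> [l0 lj]; rewrite l0/= -[leLHS](sqr_sqrtr l0) lerXn2r ?nnegrE ?sqrtr_ge0//.
  move=> /andP[l0 lj]; split => //.
  by rewrite -(@ler_pXn2r _ 2)// ?nnegrE ?sqrtr_ge0 ?exprn_ge0// sqr_sqrtr.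
exact: measurable_itv.
Qed.
#[local] Hint Resolve measurable_dyadic_band : core.

Lemma dyadic_bandS j : dyadic_band j `<=` dyadic_band j.+1.
Proof.
move=> l [l0 lj]; split => //; apply: le_trans lj _.
by rewrite ler_weXn2l// ler1n.
Qed.

Lemma best_approximationE f j :
  best_approximation E f (2 ^+ j) = hnorm (f - dyadic_proj j f).
Proof. exact: (inf_dist_range_pvm E f (measurable_dyadic_band j)). Qed.

Let phi_le j l : dyadic_band j l -> phi l <= B ^+ j.
Proof.
move=> [l0 lj]; rewrite phiE// -exprM mulnC exprM lerXn2r// ?nnegrE ?sqrtr_ge0//.
Qed.

(* Bernstein inequality on a part A of the band *)
Let integral_band_le j f A : measurable A -> A `<=` dyadic_band j ->
  (\int[mu f]_(l in A) (phi l ^+ 2)%:E <= ((B ^+ j * hnorm (E A f)) ^+ 2)%:E)%E.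
Proof.
move=> mA Aj; rewrite exprMn EFinM -[X in (_ * X)%E]/(mu f A) -integral_cst//.
apply: ge0_le_integral => // l Al; rewrite lee_fin lerXn2r ?nnegrE ?powR_ge0//.
exact/phi_le/Aj.
Qed.

Let integral_band_pvm j f :
  (\int[mu (E (dyadic_band j) f)]_l (phi l ^+ 2)%:E =
   \int[mu f]_(l in dyadic_band j) (phi l ^+ 2)%:E)%E.
Proof.
apply: integral_spectral_measure_pvm => [||l]; last exact: sqr_ge0.
  exact: measurable_dyadic_band.
exact: measurable_funX.
Qed.

Lemma smooth_dyadic_proj j f : smooth_space E r (dyadic_proj j f).
Proof.
rewrite /smooth_space /spectral_dom/= integral_band_pvm.
by rewrite (le_lt_trans (integral_band_le _ _ (@subset_refl _ _)))// ltry.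
Qed.

Let sqr_hnorm_op_proj j f :
  ((hnorm (op_power E (r%:R / 2) (dyadic_proj j f)) ^+ 2)%:E =
   \int[mu f]_(l in dyadic_band j) (phi l ^+ 2)%:E)%E.
Proof.
rewrite hnorm_spectral_integral//; last exact: smooth_dyadic_proj.
exact: integral_band_pvm.
Qed.

Lemma smooth_norm_dyadic_proj0 f : smooth_norm E r (dyadic_proj 0 f) <= 2 * hnorm f.
Proof.
rewrite mulr2n mulrDl mul1r; apply: lerD; first exact: ler_hnorm_pvm.
apply: le_trans (ler_hnorm_pvm E f (measurable_dyadic_band 0)).
rewrite -(@ler_pXn2r _ 2)// ?nnegrE ?hnorm_ge0// -lee_fin sqr_hnorm_op_proj.
apply: le_trans (integral_band_le _ (measurable_dyadic_band 0) (@subset_refl _ _)) _.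
by rewrite expr0 mul1r.
Qed.

Let B_ge1 j : 1 <= B ^+ j. Proof. by rewrite !exprn_ege1 ?ler1n. Qed.

(** The increment of [L^(r/2) P_j f] lives on the band between [2^j] and [2^(j+1)],
where [phi <= B ^+ j.+1] and the mass of [mu f] is at most the square of the error
[hnorm (f - P_j f)]. *)
Lemma smooth_norm_dyadic_projS j f : smooth_norm E r (dyadic_proj j.+1 f) <=
  smooth_norm E r (dyadic_proj j f) + 2 * (B ^+ j.+1 * hnorm (f - dyadic_proj j f)).
Proof.
rewrite mulr2n mulrDl mul1r addrACA.
have mD : measurable (dyadic_band j.+1 `\` dyadic_band j) by exact: measurableD.
apply: lerD.
  have -> : dyadic_proj j.+1 f =
      dyadic_proj j f + E (dyadic_band j.+1) (f - dyadic_proj j f).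
    have -> : E (dyadic_band j.+1) (f - dyadic_proj j f) =
        dyadic_proj j.+1 f - dyadic_proj j f.
      rewrite pvmB//; congr (_ - _); rewrite /dyadic_proj -pvmI// setIidr//.
      exact: dyadic_bandS.
    by rewrite addrC subrK.
  apply: le_trans (ler_hnormD _ _) _; rewrite lerD2l.
  by rewrite (le_trans (ler_hnorm_pvm _ _ _))// ler_peMl// hnorm_ge0.
set x := B ^+ _ * _; have x0 : 0 <= x by rewrite mulr_ge0 ?hnorm_ge0// !exprn_ge0.
set a := hnorm _; set b := hnorm _.
rewrite -(@ler_pXn2r _ 2)// ?nnegrE ?addr_ge0 ?hnorm_ge0//.
apply: (@le_trans _ _ (b ^+ 2 + x ^+ 2)); last first.
  by rewrite sqrrD lerD2r lerDl mulrn_wge0// mulr_ge0// hnorm_ge0.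
rewrite -lee_fin EFinD !sqr_hnorm_op_proj -(setDUK (@dyadic_bandS j)).
rewrite (@ge0_integral_setU _ (measurableTypeR R) R (mu f) _ _
  (measurable_dyadic_band j) mD)//; last by apply/disj_setPS => l [? []].
rewrite leeD2l//; apply: le_trans (integral_band_le _ mD (@subDsetl _ _ _)) _.
rewrite lee_fin !exprMn ler_pM2l ?exprn_gt0//.
rewrite sqr_hnorm_subr_pvm// lerXn2r ?nnegrE ?hnorm_ge0//.
by apply: ler_hnorm_pvmS => //; exact: measurableC.
Qed.

(** Outside of the band the spectrum is in []4^j, +oo[], where [phi >= B ^+ j]; the
negative half-line, on which [phi = 1], has to be discarded beforehand. *)
Lemma jackson j f : smooth_space E r f ->
  B ^+ j * hnorm (f - dyadic_proj j f) <= hnorm (op_power E (r%:R / 2) f).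
Proof.
move=> fr; rewrite -(@ler_pXn2r _ 2)// ?nnegrE ?mulr_ge0 ?hnorm_ge0 ?exprn_ge0//.
rewrite exprMn sqr_hnorm_subr_pvm// -lee_fin hnorm_spectral_integral//.
have mnn : measurable (`[0, +oo[%classic : set R) by exact: measurable_itv.
have -> : E (~` dyadic_band j) f =
    E (~` dyadic_band j `&` `[0, +oo[%classic) f.
  rewrite pvmI//; last exact: measurableC.
  congr (E _ _); apply/eqP; rewrite -subr_eq0; apply/eqP/hnorm_eq0/eqP.
  rewrite -sqrf_eq0 sqr_hnorm_subr_pvm//.
  by rewrite setCitvr E_neg hnorm0 expr0n.
set A := _ `&` _.
have mA : measurable A by apply: measurableI => //; exact: measurableC.
rewrite EFinM -[X in (_ * X)%E]/(mu f A) -integral_cst//.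
apply: (@le_trans _ _ (\int[mu f]_(l in A) (phi l ^+ 2)%:E)%E); last first.
  exact: ge0_subset_integral.
apply: ge0_le_integral => //.
  by move=> l _; rewrite lee_fin sqr_ge0.
move=> l [lj]; rewrite /= in_itv/= andbT => l0; rewrite lee_fin lerXn2r ?nnegrE ?powR_ge0//.
rewrite phiE// -exprM mulnC exprM lerXn2r// ?nnegrE ?sqrtr_ge0 ?exprn_ge0//.
by have [//|lj'] := leP; exfalso; apply: lj; split => //; exact: ltW.
Qed.

End jackson_bernstein.

(** * The K-functional *)

Section K_functional_bounds.
Context {R : realType} {H : hilbertType R} (E : pvm H).
Hypothesis E_neg : forall f, E `]-oo, 0[%classic f = 0.
Variable r : nat.
Implicit Types (f g : H) (t : R) (j : nat).

Local Notation B := (2 ^+ r : R).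
Local Notation K := (K_functional E r).

Let smooth_norm_ge0 g : 0 <= smooth_norm E r g.
Proof. by rewrite addr_ge0 ?hnorm_ge0. Qed.

Lemma K_functional_le f g t : 0 <= t -> smooth_space E r g ->
  K f t <= hnorm (f - g) + t * smooth_norm E r g.
Proof.
move=> t0 gr; apply: ge_inf; last by exists (f - g), g; rewrite subrK.
exists 0 => _ [f0 [f1 [_ _ ->]]].
by rewrite addr_ge0 ?mulr_ge0 ?hnorm_ge0.
Qed.

Lemma K_functional_ge f t (x : R) :
  (forall f0 f1, f = f0 + f1 -> smooth_space E r f1 ->
    x <= hnorm f0 + t * smooth_norm E r f1) -> x <= K f t.
Proof.
move=> xf; apply: lb_le_inf.
  have p0r := smooth_dyadic_proj E r 0 f.
  exists (hnorm (f - dyadic_proj E 0 f) + t * smooth_norm E r (dyadic_proj E 0 f)).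
  by exists (f - dyadic_proj E 0 f), (dyadic_proj E 0 f); rewrite subrK.
by move=> _ [f0 [f1 [ff01 f1r ->]]]; exact: xf.
Qed.

Lemma K_functional_ge0 f t : 0 <= t -> 0 <= K f t.
Proof.
by move=> t0; apply: K_functional_ge => *; rewrite addr_ge0 ?mulr_ge0 ?hnorm_ge0.
Qed.

Lemma K_functional_le_hnorm f t : 0 <= t -> K f t <= hnorm f.
Proof.
(* the splitting f = f + 0, with 0 seen as a projection *)
move=> t0; have r0 := smooth_dyadic_proj E r 0 (0 : H).
have P0 : dyadic_proj E 0 (0 : H) = 0.
  apply: hnorm_eq0; apply/eqP.
  rewrite eq_le hnorm_ge0 -[leRHS](@hnorm0 R H) andbT.
  by apply: ler_hnorm_pvm; exact: measurable_dyadic_band.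
have := smooth_norm_dyadic_proj0 E r (0 : H); rewrite hnorm0 mulr0.
rewrite P0 in r0 *; move=> n0; apply: le_trans (K_functional_le _ t0 r0) _.
by rewrite subr0 gerDl mulr_ge0_le0.
Qed.

Lemma hnorm_le_K_functional1 f : hnorm f <= K f 1.
Proof.
apply: K_functional_ge => f0 f1 -> _; rewrite mul1r.
apply: le_trans (ler_hnormD _ _) _; rewrite lerD2l.
by rewrite /smooth_norm lerDl hnorm_ge0.
Qed.

Lemma K_functional_homo f s t : 0 <= s -> s <= t -> K f s <= K f t.
Proof.
move=> s0 st; apply: K_functional_ge => f0 f1 ff01 f1r.
apply: le_trans (K_functional_le _ s0 f1r) _.
by rewrite ff01 addrK lerD2l ler_wpM2r.
Qed.

Lemma K_functionalM_le f (c : R) t : 1 <= c -> 0 <= t -> K f (c * t) <= c * K f t.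
Proof.
move=> c1 t0; have c0 : 0 < c by rewrite (lt_le_trans _ c1).
rewrite -ler_pdivrMl//; apply: K_functional_ge => f0 f1 ff01 f1r.
rewrite ler_pdivrMl//; apply: le_trans (K_functional_le _ _ f1r) _.
  by rewrite mulr_ge0// ltW.
by rewrite ff01 addrK [leRHS]mulrDr mulrA lerD2r ler_peMl ?hnorm_ge0.
Qed.

(** For a splitting [f = f0 + f1] the error is at most that of [f0], bounded by its
norm, plus that of [f1], bounded by [jackson]. *)
Lemma hnorm_sub_dyadic_proj_le_K_functional f j :
  hnorm (f - dyadic_proj E j f) <= K f (B ^- j).
Proof.
have mj := @measurable_dyadic_band R j.
apply: K_functional_ge => f0 f1 -> f1r.
have -> : f0 + f1 - dyadic_proj E j (f0 + f1) =
    (f0 - dyadic_proj E j f0) + (f1 - dyadic_proj E j f1).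
  rewrite addrACA -opprD /dyadic_proj; congr (_ - _).
  by rewrite -[in LHS](scale1r f0) pvm_linear// scale1r.
apply: le_trans (ler_hnormD _ _) _; apply: lerD; first exact: ler_hnorm_subr_pvm.
rewrite mulrC ler_pdivlMr ?exprn_gt0// mulrC.
by apply: le_trans (jackson E_neg j f1r) _; rewrite lerDr hnorm_ge0.
Qed.

Lemma K_functional_le_dyadic f j : K f (B ^- j) <=
  hnorm (f - dyadic_proj E j f) + B ^- j * smooth_norm E r (dyadic_proj E j f).
Proof.
by apply: K_functional_le; [rewrite invr_ge0 !exprn_ge0|exact: smooth_dyadic_proj].
Qed.

End K_functional_bounds.

(** * Contracting recursions in l^p *)

Section discrete_hardy.
Context {R : realType}.

Lemma powR_convex_combination (p s x y : R) : 1 <= p -> 0 <= s <= 1 ->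
  0 <= x -> 0 <= y ->
  (s * x + (1 - s) * y) `^ p <= s * x `^ p + (1 - s) * y `^ p.
Proof.
move=> p1 /andP[s0 s1] x0 y0.
have := @convex_powR R p p1 (Itv01 s0 s1) x y.
rewrite !inE/= !in_itv/= x0 y0 => /(_ isT isT).
by rewrite !convRE.
Qed.

Lemma powRD_le (p x y : R) : 1 <= p -> 0 <= x -> 0 <= y ->
  (x + y) `^ p <= 2 `^ p * (x `^ p + y `^ p).
Proof.
move=> p1 x0 y0; have p0 : 0 <= p by rewrite (le_trans _ p1).
wlog xy : x y x0 y0 / x <= y.
  move=> h; have [xy|/ltW yx] := leP x y; first exact: h.
  by rewrite addrC [X in _ * X]addrC; exact: h.
apply: (@le_trans _ _ ((2 * y) `^ p)).
  by apply: ge0_ler_powR; rewrite ?nnegrE ?addr_ge0 ?mulr_ge0//; lra.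
by rewrite powRM// ler_pM2l ?powR_gt0// lerDr powR_ge0.
Qed.

Lemma ler_sum_geometric (rho : R) n : 0 <= rho -> rho < 1 ->
  \sum_(0 <= j < n) rho ^+ j <= (1 - rho)^-1.
Proof.
move=> rho0 rho1; have rho10 : 0 < 1 - rho by rewrite subr_gt0.
rewrite -[leRHS]mul1r ler_pdivlMr// mulrC big_mkord.
have := subrX1 rho n; have := exprn_ge0 n rho0.
set S := \sum_(_ < _) _; rewrite !mulrBl mul1r; lra.
Qed.

(** A sequence that obeys [w_(j+1) <= rho w_j + c a_j] is dominated in l^p by
its forcing term: convexity of the p-th power, applied to the combination
[rho w_j + (1 - rho) (c a_j / (1 - rho))], turns the recursion into one for the
p-th powers, and summing that recursion absorbs the sum of [w_j ^ p]. *)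
Lemma sum_powR_recursion (p rho c W : R) (a w : nat -> R) n :
  1 <= p -> 0 <= rho -> rho < 1 -> 0 <= c ->
  (forall j, 0 <= a j) -> (forall j, 0 <= w j) -> w 0%N <= W ->
  (forall j, w j.+1 <= rho * w j + c * a j) ->
  \sum_(0 <= j < n) w j `^ p <=
  (1 - rho)^-1 * W `^ p + (c / (1 - rho)) `^ p * \sum_(0 <= j < n) a j `^ p.
Proof.
move=> p1 rho0 rho1 c0 a0 w0 wW wS; have p0 : 0 <= p by rewrite (le_trans _ p1).
have rho10 : 0 < 1 - rho by rewrite subr_gt0.
have wSp j : w j.+1 `^ p <=
    rho * w j `^ p + (1 - rho) * ((c / (1 - rho)) `^ p * a j `^ p).
  have ca0 : 0 <= c / (1 - rho) by rewrite divr_ge0// ltW.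
  rewrite -powRM//; apply: le_trans (powR_convex_combination p1 _ _ _) => //; last 2 first.
  - by rewrite rho0 ltW.
  - by rewrite mulr_ge0.
  have wS' : w j.+1 <= rho * w j + (1 - rho) * (c / (1 - rho) * a j).
    by rewrite mulrA [(1 - rho) * _]mulrC divfK ?gt_eqF.
  by apply: ge0_ler_powR => //; rewrite nnegrE// (le_trans (w0 _) wS').
set S := \sum_(_ <= _ < _) _; set T := \sum_(_ <= _ < _) _.
suff : S <= W `^ p + (rho * S + (1 - rho) * ((c / (1 - rho)) `^ p * T)).
  move=> SW; rewrite -(ler_pM2l rho10) mulrDr mulVKf ?gt_eqF//; lra.
apply: (@le_trans _ _ (\sum_(0 <= j < n.+1) w j `^ p)).
  by rewrite big_nat_recr//= lerDl powR_ge0.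
rewrite big_nat_recl//= !mulr_sumr -big_split/=; apply: lerD.
  by apply: ge0_ler_powR; rewrite ?nnegrE// (le_trans (w0 0%N)).
by apply: ler_sum => j _; exact: wSp.
Qed.

Lemma sup_recursion (rho c W s : R) (a w : nat -> R) j :
  0 <= rho -> rho < 1 -> 0 <= c -> 0 <= W -> 0 <= s ->
  (forall j, a j <= s) -> w 0%N <= W ->
  (forall j, w j.+1 <= rho * w j + c * a j) ->
  w j <= (W + c * s) / (1 - rho).
Proof.
move=> rho0 rho1 c0 W0 s0 as_ wW wS; have rho10 : 0 < 1 - rho by rewrite subr_gt0.
have cs0 : 0 <= c * s by rewrite mulr_ge0.
elim: j => [|j IH].
  rewrite ler_pdivlMr//; apply: le_trans (_ : W <= _); last by rewrite lerDl.
  by apply: le_trans (ler_wpM2r (ltW rho10) wW) _; rewrite ler_piMr//; lra.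
apply: le_trans (wS j) _; apply: (@le_trans _ _ (rho * ((W + c * s) / (1 - rho)) + c * s)).
  by apply: lerD; rewrite ler_wpM2l.
rewrite -lerBrDl; set x := _ / _.
have -> : x - rho * x = W + c * s.
  by rewrite -{1}[x]mul1r -mulrBl mulrC divfK ?gt_eqF.
by rewrite lerDr.
Qed.

End discrete_hardy.

Lemma nneseries_le {R : realType} (u : nat -> \bar R) (x : \bar R) :
  (forall j, 0 <= u j)%E -> (forall n, \sum_(0 <= j < n) u j <= x)%E ->
  (\sum_(0 <= j <oo) u j <= x)%E.
Proof.
move=> u0 ux; apply: lime_le; first exact: is_cvg_nneseries.
exact: nearW.
Qed.

(** * Weighted norms of a K-functional on dyadic cells *)

(** In this section [K] is the K-functional of a vector of norm [N], [e j] its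
approximation error at bandwidth [2 ^+ j] and [M j] the smooth norm of its
projection; the hypotheses are the Jackson and Bernstein estimates. *)
Section weighted_K.
Context {R : realType}.
Variables (B theta : R).
Hypotheses (B_gt1 : 1 < B) (theta_gt0 : 0 < theta) (theta_lt1 : theta < 1).

Local Notation A := (B `^ theta).
Local Notation rho := (A / B).
Local Notation weight t := (t `^ (- theta)).

Let B_gt0 : 0 < B. Proof. exact: lt_trans B_gt1. Qed.
Let B_ge0 : 0 <= B. Proof. exact: ltW. Qed.

Let powB_gt1 s : 0 < s -> 1 < B `^ s.
Proof.
move=> s0; have <- : 1 `^ s = 1 :> R by rewrite powR1.
by rewrite gt0_ltr_powR// ?nnegrE.
Qed.

Let A_gt1 : 1 < A. Proof. exact: powB_gt1. Qed.

Let A_gt0 : 0 < A. Proof. exact: lt_trans A_gt1. Qed.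

Let rho_ge0 : 0 <= rho. Proof. by rewrite divr_ge0// ltW. Qed.

Let rho_lt1 : rho < 1.
Proof.
rewrite ltr_pdivrMr// mul1r.
have BE : B = A * B `^ (1 - theta).
  by rewrite -powRD ?(gt_eqF B_gt0) ?implybT// addrC subrK powRr1.
by rewrite [ltRHS]BE ltr_pMr// powB_gt1// subr_gt0.
Qed.

Let weight_dyadic j : weight (B ^- j) = A ^+ j.
Proof.
by rewrite -powR_invn// -powRrM mulrNN mulrC powRrM powR_mulrn// powR_ge0.
Qed.

Let weight_dyadicV j : weight (B ^+ j) = A ^- j.
Proof.
by rewrite powRN -powR_mulrn// -powRrM mulrC powRrM powR_mulrn// powR_ge0.
Qed.

Let weight_le s t : 0 < s -> s <= t -> weight t <= weight s.
Proof.
move=> s0 st; have t0 := lt_le_trans s0 st.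
rewrite !powRN lef_pV2 ?posrE ?powR_gt0//.
by apply: ge0_ler_powR; rewrite ?nnegrE//; exact: ltW.
Qed.

Variables (K : R -> R) (e M : nat -> R) (N : R).
Hypotheses (K_ge0 : forall t, 0 <= t -> 0 <= K t)
  (K_homo : forall s t, 0 <= s -> s <= t -> K s <= K t)
  (KM_le : forall c t, 1 <= c -> 0 <= t -> K (c * t) <= c * K t)
  (K_leN : forall t, 0 <= t -> K t <= N)
  (N_leK : N <= K 1)
  (e_ge0 : forall j, 0 <= e j)
  (e_leK : forall j, e j <= K (B ^- j))
  (K_le : forall j, K (B ^- j) <= e j + B ^- j * M j)
  (M_ge0 : forall j, 0 <= M j)
  (M0_le : M 0%N <= 2 * N)
  (MS_le : forall j, M j.+1 <= M j + 2 * (B ^+ j.+1 * e j)).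

Let N_ge0 : 0 <= N. Proof. exact: le_trans (K_ge0 ler01) (K_leN ler01). Qed.

Let Bj_gt0 j : 0 < B ^- j. Proof. by rewrite invr_gt0 exprn_gt0. Qed.

Definition dyadic_cell j : set R := `]B ^- j, B * B ^- j]%classic.

Let a j := A ^+ j * e j.
Let b j := A ^+ j * K (B ^- j).
Let w j := rho ^+ j * M j.

Let a_ge0 j : 0 <= a j. Proof. by rewrite mulr_ge0// exprn_ge0// ltW. Qed.
Let b_ge0 j : 0 <= b j.
Proof. by rewrite mulr_ge0 ?K_ge0 ?exprn_ge0// ltW. Qed.
Let w_ge0 j : 0 <= w j. Proof. by rewrite mulr_ge0// exprn_ge0. Qed.

Let a_le_b j : a j <= b j.
Proof. by rewrite ler_wpM2l// exprn_ge0// ltW. Qed.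

Let w0_le : w 0%N <= 2 * N. Proof. by rewrite /w expr0 mul1r. Qed.

(* The exponent theta < 1 makes rho = A / B < 1, so this is a contraction *)
Let wS_le j : w j.+1 <= rho * w j + (2 * A) * a j.
Proof.
rewrite /w; apply: le_trans (ler_wpM2l _ (MS_le j)) _; first exact: exprn_ge0.
have rhoB : rho ^+ j.+1 * B ^+ j.+1 = A ^+ j.+1 by rewrite -exprMn divfK ?gt_eqF.
by rewrite mulrDr mulrCA [rho ^+ _ * (B ^+ _ * _)]mulrA rhoB /a !exprS !mulrA.
Qed.

Let b_le j : b j <= a j + w j.
Proof.
rewrite /b; apply: le_trans (ler_wpM2l _ (K_le j)) _.
  by rewrite exprn_ge0// ltW.
by rewrite mulrDr lerD2l mulrA /w expr_div_n.
Qed.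

Let weighted_K_cell_le j t : dyadic_cell j t -> weight t * K t <= B * b j.
Proof.
rewrite /dyadic_cell/= in_itv/= => /andP[jt tj]; have t0 := lt_trans (Bj_gt0 j) jt.
rewrite /b mulrCA; apply: ler_pM.
- exact: powR_ge0.
- exact/K_ge0/ltW.
- by rewrite -weight_dyadic; apply: weight_le => //; exact: ltW.
- apply: le_trans (K_homo (ltW t0) tj) (KM_le (ltW B_gt1) _); exact: ltW.
Qed.

Let weighted_K_cell_ge j t : dyadic_cell j t -> b j / A <= weight t * K t.
Proof.
rewrite /dyadic_cell/= in_itv/= => /andP[jt tj]; have t0 := lt_trans (Bj_gt0 j) jt.
rewrite /b mulrAC; apply: ler_pM.
- by rewrite divr_ge0 ?exprn_ge0// ltW.
- exact/K_ge0/ltW.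
- apply: le_trans (weight_le t0 tj).
  by rewrite powRM ?(ltW (Bj_gt0 j))// weight_dyadic mulrC powRN.
- by apply: K_homo; exact: ltW.
Qed.

Let exists_dyadic_lt t : 0 < t -> exists j, B ^- j < t.
Proof.
move=> t0; have /cvgrPdist_lt/(_ t t0)[j _ /(_ j (leqnn j))] :
    geometric 1 B^-1 @ \oo --> (0 : R).
  by apply: cvg_geometric; rewrite ger0_norm ?invr_ge0// invf_lt1.
rewrite /geometric/= mul1r sub0r normrN exprVn ger0_norm; last exact: ltW.
by move=> jt; exists j.
Qed.

Let dyadic_cell_cover t : 0 < t -> t <= B -> exists j, dyadic_cell j t.
Proof.
move=> t0 tB; case: (ex_minnP (exists_dyadic_lt t0)) => j jt jmin; exists j.
rewrite /dyadic_cell/= in_itv/= jt/=; case: j jt jmin => [|j] jt jmin.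
  by rewrite expr0 invr1 mulr1.
rewrite exprS invfM mulVKf ?gt_eqF// leNgt; apply/negP => /jmin.
by rewrite ltnn.
Qed.

(* Together with the cells, the tails ]B^(j+1), B B^(j+1)] cover ]0, +oo[ *)
Definition dyadic_tail j : set R := `]B ^+ j.+1, B * B ^+ j.+1]%classic.

Let dyadic_tail_cover t : B < t -> exists j, dyadic_tail j t.
Proof.
move=> Bt; have t0 := lt_trans B_gt0 Bt.
have exP : exists j, t <= B ^+ j.
  have [|j jt] := @exists_dyadic_lt t^-1; first by rewrite invr_gt0.
  by exists j; rewrite ltW// -ltf_pV2 ?posrE// exprn_gt0.
case: (ex_minnP exP) => -[|[|j]] jt jmin.
- by move: jt; rewrite expr0 leNgt (lt_trans B_gt1).
- by move: jt; rewrite expr1 leNgt Bt.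
exists j; rewrite /dyadic_tail/= in_itv/= -exprS; apply/andP; split=> //.
by rewrite ltNge; apply/negP => /jmin; rewrite ltnn.
Qed.

Let dyadic_cell_gt0 j : dyadic_cell j `<=` `]0, +oo[%classic.
Proof.
move=> t; rewrite /dyadic_cell/= !in_itv/= andbT => /andP[jt _].
exact: lt_trans jt.
Qed.

Let dyadic_tail_gt0 j : dyadic_tail j `<=` `]0, +oo[%classic.
Proof.
move=> t; rewrite /dyadic_tail/= !in_itv/= andbT => /andP[jt _].
by apply: lt_trans jt; rewrite exprn_gt0.
Qed.

Let trivIset_dyadic_cell : trivIset setT dyadic_cell.
Proof.
apply: ltn_trivIset => j i ij; rewrite -subset0 => t [].
rewrite /dyadic_cell/= !in_itv/= => /andP[it _] /andP[_]; apply/negP.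
rewrite -ltNge; apply: le_lt_trans it.
case: j ij => // j ij; rewrite exprS invfM mulVKf ?gt_eqF//.
by rewrite lef_pV2 ?posrE ?exprn_gt0// ler_weXn2l// ltW.
Qed.

Let trivIset_dyadic_tail : trivIset setT dyadic_tail.
Proof.
apply: ltn_trivIset => j i ij; rewrite -subset0 => t [].
rewrite /dyadic_tail/= !in_itv/= => /andP[_ ti] /andP[tj _].
move: (lt_le_trans tj ti); apply/negP; rewrite -leNgt -exprS.
by rewrite ler_weXn2l// ltW.
Qed.

Section finite_exponent.
Variable p : R.
Hypothesis p_ge1 : 1 <= p.

Let p_ge0 : 0 <= p. Proof. exact: le_trans p_ge1. Qed.

Local Notation mu := (@lebesgue_measure R).
Local Notation G t := ((weight t * K t) `^ p / t).

Let G_ge0 t : 0 <= t -> 0 <= G t.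
Proof. by move=> t0; rewrite divr_ge0 ?powR_ge0. Qed.

Let mG : measurable_fun (`]0, +oo[%classic : set R) (fun t => (G t)%:E).
Proof.
apply/measurable_EFinP.
(* extended by 0, K is nondecreasing on the whole line *)
pose K' t := if 0 < t then K t else 0.
apply: (@eq_measurable_fun _ _ _ _ _ (fun t => (weight t * K' t) `^ p * t `^ (-1))).
  move=> t; rewrite inE/= in_itv/= andbT => t0.
  by rewrite /K' t0 powR_inv1// ltW.
have mK' : measurable_fun (`]0, +oo[%classic : set R) K'.
  apply: nondecreasing_measurable => // s t st; rewrite /K'.
  case: ifPn => s0; first by rewrite (lt_le_trans s0 st); apply: K_homo => //; exact: ltW.
  by case: ifPn => // t0; apply: K_ge0; exact: ltW.
apply: measurable_funM; last by apply: measurable_funTS; exact: measurable_powR.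
apply: (measurableT_comp (measurable_powR p)).
by apply: measurable_funM => //; apply: measurable_funTS; exact: measurable_powR.
Qed.

Let mG_cell (u v : R) : 0 < u ->
  measurable_fun (`]u, v]%classic : set R) (fun t => (G t)%:E).
Proof.
move=> u0; apply: measurable_funS mG => //.
by move=> t; rewrite /= !in_itv/= andbT => /andP[/(lt_trans u0)].
Qed.

(* On a cell ]u, B u] the measure dt / t has mass between (B - 1) / B and B - 1. *)
Let integral_cell_le (u c : R) : 0 < u -> 0 <= c ->
  (forall t, u < t -> t <= B * u -> weight t * K t <= c) ->
  (\int[mu]_(t in `]u, (B * u)%R]) (G t)%:E <= ((B - 1) * c `^ p)%:E)%E.
Proof.
move=> u0 c0 Gc.
apply: (@le_trans _ _ (\int[mu]_(t in `]u, (B * u)%R]) (cst (c `^ p / u)%:E t))%E).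
  apply: ge0_le_integral => //.
  - move=> t /=; rewrite in_itv/= => /andP[ut _]; rewrite lee_fin G_ge0// ltW//.
    exact: lt_trans ut.
  - exact: mG_cell.
  - move=> t /=; rewrite in_itv/= => /andP[ut tu]; have t0 := lt_trans u0 ut.
    have WK0 : 0 <= weight t * K t by rewrite mulr_ge0 ?powR_ge0// K_ge0// ltW.
    rewrite lee_fin; apply: ler_pM; rewrite ?powR_ge0 ?invr_ge0 ?(ltW t0)//.
      by apply: ge0_ler_powR; rewrite ?nnegrE// Gc.
    by rewrite lef_pV2 ?posrE// ltW.
rewrite integral_cst//= lebesgue_measure_itv/= lte_fin ltr_pMl// B_gt1.
rewrite -EFinB -EFinM lee_fin le_eqVlt; apply/orP; left; apply/eqP.
by field; rewrite gt_eqF.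
Qed.

Let integral_cell_ge (u c : R) : 0 < u -> 0 <= c ->
  (forall t, u < t -> t <= B * u -> c <= weight t * K t) ->
  (((B - 1) / B * c `^ p)%:E <= \int[mu]_(t in `]u, (B * u)%R]) (G t)%:E)%E.
Proof.
move=> u0 c0 Gc; have Bu0 : 0 < B * u by rewrite mulr_gt0.
apply: (@le_trans _ _
  (\int[mu]_(t in `]u, (B * u)%R]) (cst (c `^ p / (B * u))%:E t))%E).
  rewrite integral_cst//= lebesgue_measure_itv/= lte_fin ltr_pMl// B_gt1.
  rewrite -EFinB -EFinM lee_fin le_eqVlt; apply/orP; left; apply/eqP.
  by field; rewrite !gt_eqF.
apply: ge0_le_integral => //.
- by move=> t _; rewrite lee_fin divr_ge0 ?powR_ge0// ltW.
- exact: mG_cell.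
- move=> t /=; rewrite in_itv/= => /andP[ut tu]; have t0 := lt_trans u0 ut.
  rewrite lee_fin; apply: ler_pM; rewrite ?powR_ge0 ?invr_ge0 ?(ltW Bu0)//.
    have WKc := Gc _ ut tu.
    by apply: ge0_ler_powR; rewrite ?nnegrE// (le_trans c0).
  by rewrite lef_pV2 ?posrE.
Qed.

Let integral_bigcup_cells (F : nat -> set R) :
  (forall j, measurable (F j)) -> (forall j, F j `<=` `]0, +oo[%classic) ->
  trivIset setT F ->
  (\sum_(0 <= j <oo) \int[mu]_(t in F j) (G t)%:E =
   \int[mu]_(t in \bigcup_j F j) (G t)%:E)%E.
Proof.
move=> mF F0 tF.
have U0 : \bigcup_j F j `<=` `]0, +oo[%classic by move=> t [j _ /F0].
rewrite ge0_integral_bigcup//.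
  by apply: measurable_funS mG.
move=> t /U0/=; rewrite in_itv/= andbT => t0.
by rewrite lee_fin G_ge0// ltW.
Qed.

Let measurable_dyadic_cell j : measurable (dyadic_cell j).
Proof. exact: measurable_itv. Qed.

Let measurable_dyadic_tail j : measurable (dyadic_tail j).
Proof. exact: measurable_itv. Qed.

Local Notation X := (\int[mu]_(t in `]0%R, +oo[) (G t)%:E)%E.
Local Notation S := (\sum_(0 <= j <oo) ((A ^+ j * e j) `^ p)%:E)%E.

Let G0 t : (`]0, +oo[%classic : set R) t -> (0 <= (G t)%:E)%E.
Proof. by rewrite /= in_itv/= andbT => t0; rewrite lee_fin G_ge0// ltW. Qed.

Definition lower_const : R := (B - 1) / B * A^-1 `^ p.

Let integral_dyadic_cell_ge j :
  ((lower_const * b j `^ p)%:E <= \int[mu]_(t in dyadic_cell j) (G t)%:E)%E.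
Proof.
have -> : lower_const * b j `^ p = (B - 1) / B * (b j / A) `^ p.
  by rewrite /lower_const -mulrA -powRM ?invr_ge0 ?(ltW A_gt0)// [A^-1 * _]mulrC.
apply: integral_cell_ge; [exact: Bj_gt0|by rewrite divr_ge0// ltW|].
by move=> t jt tj; apply: weighted_K_cell_ge; rewrite /dyadic_cell/= in_itv/= jt.
Qed.

Lemma lower_const_gt0 : 0 < lower_const.
Proof.
by rewrite mulr_gt0 ?powR_gt0 ?invr_gt0// divr_gt0// subr_gt0.
Qed.

Let sum_le_integral : (lower_const%:E * S <= X)%E.
Proof.
rewrite -nneseriesZl; last by move=> j _; rewrite lee_fin powR_ge0.
apply: (@le_trans _ _ (\sum_(0 <= j <oo) \int[mu]_(t in dyadic_cell j) (G t)%:E)%E).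
  apply: lee_nneseries => [j _ _|j _].
    by rewrite -EFinM lee_fin mulr_ge0 ?powR_ge0// ltW// lower_const_gt0.
  apply: le_trans (integral_dyadic_cell_ge j); rewrite -EFinM lee_fin.
  rewrite ler_pM2l ?lower_const_gt0//.
  by apply: ge0_ler_powR; rewrite ?nnegrE//; [exact: a_ge0|exact: a_le_b].
rewrite integral_bigcup_cells//.
apply: ge0_subset_integral => //; first exact: bigcupT_measurable.
by move=> t [j _ /dyadic_cell_gt0].
Qed.

Let powR_le_integral : (lower_const%:E * (N `^ p)%:E <= X)%E.
Proof.
apply: (@le_trans _ _ (\int[mu]_(t in dyadic_cell 0) (G t)%:E)%E).
  apply: le_trans (integral_dyadic_cell_ge 0); rewrite -EFinM lee_fin.
  rewrite ler_pM2l ?lower_const_gt0//; apply: ge0_ler_powR; rewrite ?nnegrE//.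
  by rewrite /b !expr0 invr1 mul1r.
by apply: ge0_subset_integral => //; exact: measurable_dyadic_cell.
Qed.

Definition cell_const : R := (B - 1) * B `^ p * 2 `^ p.
Definition upper_sum_const : R := cell_const * (1 + (2 * A / (1 - rho)) `^ p).
Definition upper_cst_const : R :=
  cell_const * ((1 - rho)^-1 * 2 `^ p) + (B - 1) * (1 - A^-1 `^ p)^-1.

Let cell_const_gt0 : 0 < cell_const.
Proof. by rewrite !mulr_gt0 ?powR_gt0// subr_gt0. Qed.

Let rho1_gt0 : 0 < 1 - rho. Proof. by rewrite subr_gt0. Qed.

Let powAV_lt1 : A^-1 `^ p < 1.
Proof.
have <- : 1 `^ p = 1 :> R by rewrite powR1.
apply: gt0_ltr_powR; rewrite ?nnegrE ?invr_ge0 ?(ltW A_gt0)//.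
  exact: lt_le_trans p_ge1.
by rewrite invf_lt1.
Qed.

Lemma upper_sum_const_gt0 : 0 < upper_sum_const.
Proof. by rewrite mulr_gt0// ltr_pwDl// powR_ge0. Qed.

Lemma upper_cst_const_ge0 : 0 <= upper_cst_const.
Proof.
apply: addr_ge0.
  apply: (mulr_ge0 (ltW cell_const_gt0)).
  by rewrite mulr_ge0 ?powR_ge0// invr_ge0 ltW.
by rewrite mulr_ge0 ?invr_ge0 ?subr_ge0 ?(ltW B_gt1) ?(ltW powAV_lt1).
Qed.

(* The sum of b_j^p is controlled by those of a_j^p and w_j^p, and the latter by
   the contracting recursion. *)
Let integral_cell_sum_le :
  (\sum_(0 <= j <oo) \int[mu]_(t in dyadic_cell j) (G t)%:E <=
   upper_sum_const%:E * S +
   (cell_const * ((1 - rho)^-1 * 2 `^ p) * N `^ p)%:E)%E.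
Proof.
have b_sum n : \sum_(0 <= j < n) b j `^ p <= 2 `^ p *
    ((1 + (2 * A / (1 - rho)) `^ p) * \sum_(0 <= j < n) a j `^ p +
     (1 - rho)^-1 * 2 `^ p * N `^ p).
  have := @sum_powR_recursion R p rho (2 * A) (2 * N) a w n p_ge1 rho_ge0 rho_lt1
    (mulr_ge0 (ler0n R 2) (ltW A_gt0)) a_ge0 w_ge0 w0_le wS_le.
  rewrite powRM// mulrA => ws.
  apply: (@le_trans _ _ (\sum_(0 <= j < n) (2 `^ p * (a j `^ p + w j `^ p)))).
    apply: ler_sum => j _; apply: le_trans (powRD_le p_ge1 (a_ge0 j) (w_ge0 j)).
    by apply: ge0_ler_powR; rewrite ?nnegrE// addr_ge0.
  rewrite -mulr_sumr ler_pM2l ?powR_gt0// big_split/=.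
  by rewrite mulrDl mul1r -addrA lerD2l addrC.
apply: nneseries_le => [j|n].
  apply: integral_ge0 => t jt; apply: G0; exact: (@dyadic_cell_gt0 j).
apply: (@le_trans _ _ (\sum_(0 <= j < n) ((B - 1) * B `^ p * b j `^ p)%:E)%E).
  apply: lee_sum => j _; rewrite -mulrA -powRM//.
  apply: integral_cell_le; [exact: Bj_gt0|by rewrite mulr_ge0|].
  by move=> t jt tj; apply: weighted_K_cell_le; rewrite /dyadic_cell/= in_itv/= jt.
rewrite sumEFin -mulr_sumr.
apply: (@le_trans _ _ (upper_sum_const%:E * (\sum_(0 <= j < n) (a j `^ p)%:E) +
   (cell_const * ((1 - rho)^-1 * 2 `^ p) * N `^ p)%:E)%E); last first.
  rewrite leeD2r// lee_wpmul2l//; last first.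
    by apply: nneseries_lim_ge => j _ _; rewrite lee_fin powR_ge0.
  by rewrite lee_fin ltW// upper_sum_const_gt0.
rewrite sumEFin -EFinM -EFinD lee_fin.
rewrite /upper_sum_const /cell_const -!mulrA -!mulrDr.
rewrite ler_pM2l ?subr_gt0// ler_pM2l ?powR_gt0//.
by have := b_sum n; rewrite -!mulrA.
Qed.

(* On the tails K <= N and the weight is at most A^-j: a geometric series *)
Let integral_tail_sum_le :
  (\sum_(0 <= j <oo) \int[mu]_(t in dyadic_tail j) (G t)%:E <=
   ((B - 1) * (1 - A^-1 `^ p)^-1 * N `^ p)%:E)%E.
Proof.
have Ap0 : 0 <= A^-1 `^ p by exact: powR_ge0.
apply: nneseries_le => [j|n].
  apply: integral_ge0 => t jt; apply: G0; exact: (@dyadic_tail_gt0 j).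
apply: (@le_trans _ _ (\sum_(0 <= j < n)
    ((B - 1) * N `^ p * (A^-1 `^ p) ^+ j)%:E)%E).
  apply: lee_sum => j _.
  have AjN0 : 0 <= A^-1 ^+ j * N by rewrite mulr_ge0// exprn_ge0// invr_ge0 ltW.
  have -> : (B - 1) * N `^ p * (A^-1 `^ p) ^+ j = (B - 1) * (A^-1 ^+ j * N) `^ p.
    rewrite -mulrA; congr (_ * _); rewrite mulrC powRM//; last first.
      by rewrite exprn_ge0// invr_ge0 ltW.
    have Ai0 : 0 <= A^-1 by rewrite invr_ge0 ltW.
    by rewrite -(powR_mulrn j Ai0) -(powR_mulrn j Ap0) powRAC.
  apply: integral_cell_le => //; first by rewrite exprn_gt0.
  move=> t jt _; have t0 : 0 < t by apply: lt_trans jt; rewrite exprn_gt0.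
  apply: ler_pM; rewrite ?powR_ge0//; [exact/K_ge0/ltW| |exact/K_leN/ltW].
  rewrite exprVn -weight_dyadicV; apply: weight_le; first by rewrite exprn_gt0.
  by apply: le_trans (ltW jt); rewrite ler_weXn2l// ltW.
rewrite sumEFin lee_fin -mulr_sumr mulrAC ler_wpM2r ?powR_ge0//.
by rewrite ler_pM2l ?subr_gt0// ler_sum_geometric.
Qed.

Let integral_le_sum :
  (X <= upper_sum_const%:E * S + upper_cst_const%:E * (N `^ p)%:E)%E.
Proof.
pose U := \bigcup_j dyadic_cell j; pose V := \bigcup_j dyadic_tail j.
have mU : measurable U by apply: bigcupT_measurable; exact: measurable_dyadic_cell.
have mV : measurable V by apply: bigcupT_measurable; exact: measurable_dyadic_tail.
have UVE : (`]0, +oo[%classic : set R) = U `|` V.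
  apply/seteqP; split=> t; last first.
    by case=> -[j _]; [exact: dyadic_cell_gt0|exact: dyadic_tail_gt0].
  rewrite /= in_itv/= andbT => t0; have [tB|Bt] := leP t B.
    by left; have [j jt] := dyadic_cell_cover t0 tB; exists j.
  by right; have [j jt] := dyadic_tail_cover Bt; exists j.
rewrite UVE ge0_integral_setU//; last 3 first.
- by rewrite -UVE.
- by rewrite -UVE.
- apply/disj_setPS => t [[j _ /=]]; rewrite /dyadic_cell/= in_itv/= => /andP[_ tj].
  move=> [i _]; rewrite /dyadic_tail/= in_itv/= => /andP[it _].
  move: (lt_le_trans it tj); apply/negP; rewrite -leNgt.
  rewrite exprS ler_pM2l// (@le_trans _ _ 1)//.
    by rewrite invf_le1 ?exprn_gt0// exprn_ege1// ltW.
  by rewrite exprn_ege1// ltW.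
rewrite -!integral_bigcup_cells//.
apply: le_trans (leeD integral_cell_sum_le integral_tail_sum_le) _.
by rewrite -addeA -EFinD -mulrDl -EFinM.
Qed.

Lemma besov_integral_equivalence :
  [/\ (lower_const%:E * S <= X)%E, (lower_const%:E * (N `^ p)%:E <= X)%E &
      (X <= upper_sum_const%:E * S + upper_cst_const%:E * (N `^ p)%:E)%E].
Proof. by split. Qed.

End finite_exponent.

Local Notation Y := (ereal_sup [set (weight t * K t)%:E | t in `]0%R, +oo[]).
Local Notation Z := (ereal_sup (range (fun j => (A ^+ j * e j)%:E))).

Lemma besov_sup_lower : (N%:E + Z <= 2%:E * Y)%E.
Proof.
have KY t : 0 < t -> ((weight t * K t)%:E <= Y)%E.
  by move=> t0; apply: ereal_sup_ubound; exists t => //=; rewrite in_itv/= andbT.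
have NY : (N%:E <= Y)%E.
  by apply: le_trans (KY 1 ltr01); rewrite lee_fin powR1 mul1r.
have ZY : (Z <= Y)%E.
  apply: ge_ereal_sup => _ [j _ <-]; apply: le_trans (KY _ (Bj_gt0 j)).
  by rewrite lee_fin weight_dyadic; exact: a_le_b.
have Y0 : (0 <= Y)%E by apply: le_trans NY; rewrite lee_fin.
by rewrite (_ : 2%:E = 1 + 1)%E// ge0_muleDl// mul1e leeD.
Qed.

Definition sup_const : R := B * (1 + (2 + 2 * A) / (1 - rho)).

Let slope_ge0 : 0 <= (2 + 2 * A) / (1 - rho).
Proof.
apply: divr_ge0; last by rewrite subr_ge0 ltW.
by apply: addr_ge0 => //; rewrite mulr_ge0// ltW.
Qed.

Lemma sup_const_gt0 : 0 < sup_const.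
Proof. by rewrite mulr_gt0// ltr_pwDl. Qed.

Lemma besov_sup_upper : (Y <= sup_const%:E * (N%:E + Z))%E.
Proof.
have rho1 : 0 < 1 - rho by rewrite subr_gt0.
have Z0 : (0 <= Z)%E.
  apply: le_trans (_ : (a 0)%:E <= Z)%E; first by rewrite lee_fin.
  by apply: ereal_sup_ubound; exists 0%N.
move EZ : Z Z0 => [z| |]// z0; last by rewrite addey// gt0_muley ?leey//
  lte_fin sup_const_gt0.
rewrite lee_fin in z0; rewrite -EFinD -EFinM.
have az j : a j <= z.
  by rewrite -lee_fin -EZ; apply: ereal_sup_ubound; exists j.
apply: ge_ereal_sup => _ [t /= + <-]; rewrite in_itv/= andbT lee_fin => t0.
have Nz0 : 0 <= N + z by rewrite addr_ge0.
have [tB|Bt] := leP t B; last first.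
  apply: (@le_trans _ _ (1 * (N + z))).
    rewrite mul1r (@le_trans _ _ (1 * N))//; last by rewrite mul1r lerDl.
    apply: ler_pM; rewrite ?powR_ge0//; [exact/K_ge0/ltW| |exact/K_leN/ltW].
    apply: le_trans (weight_le ltr01 (ltW (lt_trans B_gt1 Bt))) _.
    by rewrite powR1.
  by rewrite ler_wpM2r// mulr_ege1 ?(ltW B_gt1)// lerDl.
have [j jt] := dyadic_cell_cover t0 tB.
apply: le_trans (weighted_K_cell_le jt) _; rewrite -mulrA ler_pM2l//.
apply: le_trans (b_le j) _; rewrite mulrDl mul1r; apply: lerD.
  by rewrite (le_trans (az j))// lerDr.
have := @sup_recursion R rho (2 * A) (2 * N) z a w j rho_ge0 rho_lt1
  (mulr_ge0 (ler0n R 2) (ltW A_gt0)) (mulr_ge0 (ler0n R 2) N_ge0) z0 az w0_le wS_le.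
move=> /le_trans; apply; rewrite [leRHS]mulrAC ler_pM2r ?invr_gt0//.
have AN : 0 <= A * N by rewrite mulr_ge0// ltW.
rewrite mulrDl !mulrDr -!mulrA; lra.
Qed.

End weighted_K.

(** * From p-th powers to norms *)

Section ereal_roots.
Context {R : realType}.
Implicit Types (p c N : R) (S X : \bar R).
Local Open Scope ereal_scope.

Lemma poweR_root_lower p c N S X : (1 <= p)%R -> (0 < c)%R -> (0 <= N)%R ->
  0 <= S -> c%:E * S <= X -> c%:E * (N `^ p)%:E <= X ->
  (c `^ p^-1 / 2)%:E * (N%:E + S `^ p^-1) <= X `^ p^-1.
Proof.
move=> p1 c0 N0 S0 SX NX; have p0 : (0 < p)%R by exact: lt_le_trans p1.
have pV0 : (0 <= p^-1)%R by rewrite invr_ge0 ltW.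
have X0 : 0 <= X by apply: le_trans SX; rewrite mule_ge0// lee_fin ltW.
have root_le U V : 0 <= U -> U <= V -> U `^ p^-1 <= V `^ p^-1.
  move=> U0 UV; apply: gt0_ler_poweR => //; rewrite in_itv/= ?U0 ?leey//.
  by rewrite (le_trans U0).
have c2 : (0 <= c `^ p^-1)%R by exact: powR_ge0.
have SX' : (c `^ p^-1)%:E * S `^ p^-1 <= X `^ p^-1.
  rewrite -poweR_EFin -poweRM ?lee_fin ?(ltW c0)//; apply: root_le => //.
  by rewrite mule_ge0// lee_fin ltW.
have NX' : (c `^ p^-1)%:E * N%:E <= X `^ p^-1.
  have -> : N%:E = (N `^ p)%:E `^ p^-1.
    by rewrite poweR_EFin -powRrM divff ?gt_eqF// powRr1.
  rewrite -poweR_EFin -poweRM ?lee_fin ?powR_ge0 ?(ltW c0)//; apply: root_le => //.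
  by rewrite mule_ge0// lee_fin ?powR_ge0// ltW.
rewrite mulrC EFinM -muleA ge0_muleDr ?poweR_ge0// ?lee_fin//.
apply: (@le_trans _ _ ((2^-1)%:E * (X `^ p^-1 + X `^ p^-1))).
  by rewrite lee_wpmul2l ?lee_fin ?invr_ge0// leeD.
rewrite ge0_muleDr ?poweR_ge0// -ge0_muleDl ?lee_fin ?invr_ge0//.
by rewrite -EFinD (_ : (2^-1 + 2^-1 = 1 :> R)%R) ?mul1e//; lra.
Qed.

(** The sum is one of extended reals, possibly [+oo], so the p-th roots are taken in
[\bar R]; both [S] and [N ^ p] are at most the p-th power of [N + S ^ (1/p)]. *)
Lemma poweR_root_upper p c2 c3 N S X : (1 <= p)%R -> (0 <= c2)%R -> (0 <= c3)%R ->
  (0 <= N)%R -> 0 <= S -> 0 <= X -> X <= c2%:E * S + c3%:E * (N `^ p)%:E ->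
  X `^ p^-1 <= ((c2 + c3) `^ p^-1)%:E * (N%:E + S `^ p^-1).
Proof.
move=> p1 c20 c30 N0 S0 X0 XS; have p0 : (0 < p)%R by exact: lt_le_trans p1.
have pV0 : (0 <= p^-1)%R by rewrite invr_ge0 ltW.
set Y := N%:E + _.
have Y0 : 0 <= Y by rewrite adde_ge0 ?poweR_ge0.
have pow_le U : 0 <= U -> U <= Y -> U `^ p <= Y `^ p.
  move=> U0 UY; apply: gt0_ler_poweR; rewrite ?in_itv/= ?U0 ?Y0 ?leey//.
  exact: ltW.
have SY : S <= Y `^ p.
  have {1}-> : S = (S `^ p^-1) `^ p.
    by rewrite -poweRrM mulVf ?gt_eqF// poweRe1.
  by apply: pow_le; [exact: poweR_ge0|rewrite leeDr].
have NY : (N `^ p)%:E <= Y `^ p.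
  by rewrite -poweR_EFin; apply: pow_le; rewrite ?leeDl ?poweR_ge0.
have -> : Y = (Y `^ p) `^ p^-1 by rewrite -poweRrM divff ?gt_eqF// poweRe1.
rewrite -poweR_EFin -poweRM ?poweR_ge0 ?lee_fin ?addr_ge0//.
have XY : X <= (c2 + c3)%:E * Y `^ p.
  apply: le_trans XS _; rewrite EFinD ge0_muleDl ?lee_fin//.
  by apply: leeD; rewrite lee_wpmul2l.
apply: gt0_ler_poweR; rewrite ?in_itv/= ?X0 ?leey//.
by rewrite mule_ge0 ?poweR_ge0// lee_fin addr_ge0.
Qed.

End ereal_roots.

(** * The equivalence of norms *)

Lemma powR_dyadic_base {R : realType} (alpha : R) (r : nat) : (0 < r)%N ->
  (2 ^+ r) `^ (alpha / r%:R) = 2 `^ alpha :> R.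
Proof.
by move=> r0; rewrite -powR_mulrn// -powRrM mulrC divfK// pnatr_eq0 -lt0n.
Qed.

Lemma powR_dyadic_weight {R : realType} (alpha : R) (r j : nat) : (0 < r)%N ->
  ((2 ^+ r) `^ (alpha / r%:R)) ^+ j = 2 `^ (j%:R * alpha) :> R.
Proof.
by move=> r0; rewrite powR_dyadic_base// mulrC powRrM powR_mulrn// powR_ge0.
Qed.

Theorem theorem7p5 (R : realType) (H : hilbertType R) (L : operator H)
    (Lsa : self_adjoint L) (Lpos : positive_definite L)
    (E : pvm H) (EL : spectral_resolution E L)
    (alpha : R) (alpha_gt0 : 0 < alpha)
    (r : nat) (alpha_lt_r : alpha < r%:R)
    (q : \bar R) (q_ge1 : (1 <= q)%E) :
  exists c C : R, [/\ 0 < c, 0 < C &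
    forall f : H,
      (c%:E * approximation_norm E alpha q f <= besov_norm E r alpha q f)%E /\
      (besov_norm E r alpha q f <= C%:E * approximation_norm E alpha q f)%E].
Proof.
have E_neg := pvm_negative Lpos EL.
have r_gt0 : 0 < r%:R :> R by exact: lt_trans alpha_lt_r.
have rn0 : (0 < r)%N by rewrite -(ltr_nat R).
pose B : R := 2 ^+ r; pose theta := alpha / r%:R.
have B1 : 1 < B by rewrite exprn_egt1 ?ltr1n// -lt0n.
have th0 : 0 < theta by rewrite divr_gt0.
have th1 : theta < 1 by rewrite ltr_pdivrMr// mul1r.
pose e f j := hnorm (f - dyadic_proj E j f).
pose M f j := smooth_norm E r (dyadic_proj E j f).
have aE f j : 2 `^ (j%:R * alpha) * best_approximation E f (2 ^+ j) =
    (B `^ theta) ^+ j * e f j.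
  by rewrite powR_dyadic_weight// best_approximationE.
have e_ge0 f j : 0 <= e f j by exact: hnorm_ge0.
have M_ge0 f j : 0 <= M f j by rewrite addr_ge0 ?hnorm_ge0.
have K_ge0 f := @K_functional_ge0 _ _ E r f.
have K_homo f := @K_functional_homo _ _ E r f.
have KM_le f := @K_functionalM_le _ _ E r f.
have K_leN f := @K_functional_le_hnorm _ _ E r f.
have N_leK f := @hnorm_le_K_functional1 _ _ E r f.
have e_leK f := hnorm_sub_dyadic_proj_le_K_functional E_neg r f.
have K_le f := @K_functional_le_dyadic _ _ E r f.
have M0_le f := smooth_norm_dyadic_proj0 E r f.
have MS_le f := @smooth_norm_dyadic_projS _ _ E r ^~ f.
case: q q_ge1 => [p|_|//].
- move=> p1; exists (lower_const B theta p `^ p^-1 / 2),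
    ((upper_sum_const B theta p + upper_cst_const B theta p) `^ p^-1).
  have lc_gt0 := lower_const_gt0 B1 th0 p.
  have us_gt0 := upper_sum_const_gt0 theta B1 p.
  have uc_ge0 := upper_cst_const_ge0 B1 th0 th1 p1.
  split=> [||f]; [by rewrite divr_gt0// powR_gt0|by rewrite powR_gt0// ltr_wpDr|].
  rewrite /approximation_norm/= (eq_eseriesr (g := fun j =>
    (((B `^ theta) ^+ j * e f j) `^ p)%:E)); last by move=> j _; rewrite aE.
  have [SX NX XS] := besov_integral_equivalence B1 th0 th1 (K_ge0 f) (K_homo f)
    (KM_le f) (K_leN f) (N_leK f) (e_ge0 f) (e_leK f) (K_le f) (M_ge0 f) (M0_le f)
    (MS_le f) p1.
  have S_ge0 : (0 <= \sum_(0 <= j <oo) (((B `^ theta) ^+ j * e f j) `^ p)%:E)%E.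
    by apply: nneseries_ge0 => j _ _; rewrite lee_fin powR_ge0.
  split.
    exact: (poweR_root_lower _ _ (hnorm_ge0 f) S_ge0 SX NX).
  apply: (poweR_root_upper _ _ _ (hnorm_ge0 f) S_ge0 _ XS) => //; first exact: ltW.
  by apply: le_trans SX; apply: (mule_ge0 _ S_ge0); rewrite lee_fin ltW.
- have sc_gt0 := sup_const_gt0 B1 th0 th1.
  exists 2^-1, (sup_const B theta); split=> // f.
  rewrite /approximation_norm/=.
  rewrite (_ : (fun j =>
      (2 `^ (j%:R * alpha) * best_approximation E f (2 ^+ j))%:E) =
    (fun j => ((B `^ theta) ^+ j * e f j)%:E)); last first.
    by apply/funext => j; rewrite aE.
  split.
    rewrite -(@lee_pmul2l _ 2%:E)//.
    rewrite muleA -EFinM divff// mul1e.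
    exact: (besov_sup_lower B1 th0 (K_ge0 f) (K_leN f) (N_leK f) (e_leK f)).
  exact: (besov_sup_upper B1 th0 th1 (K_ge0 f) (K_homo f)
    (KM_le f) (K_leN f) (e_ge0 f) (K_le f) (M0_le f) (MS_le f)).
Qed.
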